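(* Let $G$ be an algebraic group, $M$ a (non-singular) affine algebraic variety with an algebraic $G$-action, and $\Phi\colon M\to G$ a $G$-equivariant morphism of affine varieties. Let $\bullet$ be a non-degenerate $\mathrm{Ad}$-invariant symmetric bilinear form on $\mathfrak g$ and let $\mathcal H\in\mathfrak g\otimes\mathfrak g$ be the $\mathrm{Ad}$-invariant symmetric $2$-tensor with $\psi^{\mathcal H}=(\psi^\bullet)^{-1}$. Suppose $(P,\Phi)$ is a Hamiltonian $G$-quasi Poisson structure on $M$ relative to $\mathcal H$ and $(\sigma,\Phi)$ a weakly $G$-quasi Hamiltonian structure on $M$ relative to $\bullet$, such that $\sigma$ and $P$ are $\Phi$-momentum dual to each other (and hence $(\sigma,\Phi)$ is a $G$-quasi Hamiltonian structure, i.e. $\sigma$ is $\Phi$-non-degenerate). Then the $2$-form $\sigma$ is algebraic if and only if its $\Phi$-momentum dual $P$ is algebraic.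
   Context: Here $\sigma$ and $P$ are a priori smooth or analytic ($\mathbb K=\mathbb R$ or $\mathbb C$). $\mathfrak g$ is the Lie algebra of $G$. For $X\in\mathfrak g$, $X_M(q)=\frac{d}{dt}|_{t=0}\exp(-tX)q$, $\mathrm{fund}_M(q,X)=X_M(q)$. $G$ acts on itself by conjugation. $X^L(q)=qX$, $X^R(q)=Xq$; $\omega,\bar\omega$ are the left/right invariant Maurer–Cartan forms. For $G$-equivariant $\Phi\colon M\to G$: $\mathrm T_\Phi G=\Phi^*\mathrm TG$, $(d\Phi)_M\colon \mathrm TM\to \mathrm T_\Phi G$ is the derivative, $L_\Phi(m,X)=\Phi(m)X$, $R_\Phi(m,X)=X\Phi(m)$, and $\rho_\Phi=\mathrm{fund}_M\circ(L_\Phi^{-1}-R_\Phi^{-1})\circ(d\Phi)_M$. $\psi^\bullet(X)=X\bullet(\cdot)$; $\psi^{\mathcal H}\colon\mathfrak g^*\to\mathfrak g$ is contraction with $\mathcal H=\sum\eta^{jk}e_j\otimes e_k$. $\sigma^\flat(X)=\sigma(X,\cdot)$; $P^\sharp(df)(h)=P(df,dh)$. $\Phi$ is a $G$-momentum mapping for a $G$-invariant $2$-form $\sigma$ relative to $\bullet$ if $\sigma(X_M,\cdot)=\frac12\Phi^*(X\bullet(\omega+\bar\omega))$ for all $X$. With $\lambda=\frac1{12}[\omega,\omega]\bullet\omega$ (i.e. $\lambda(X^L,Y^L,Z^L)=\frac12[X,Y]\bullet Z$), $(\sigma,\Phi)$ is weakly $G$-quasi Hamiltonian if moreover $d\sigma=\Phi^*\lambda$.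 $\sigma$ is $\Phi$-non-degenerate if $(\sigma^\flat,(d\Phi)_M)\colon \mathrm TM\to \mathrm T^*M\oplus_M \mathrm T_\Phi G$ is a monomorphism of vector bundles. $\Phi$ is a $G$-momentum mapping for a $G$-invariant skew-symmetric $2$-tensor $P$ relative to $\mathcal H$ if $2P^\sharp(d(f\circ\Phi))=\sum\eta^{jk}(((e_j^L+e_j^R)f)\circ\Phi)(e_k)_M$ for all functions $f$ on $G$. With $\phi_{\mathcal H}=-\frac12\sum\eta^{ju}\eta^{vs}e_j\otimes[e_u,e_v]\otimes e_s$ (totally antisymmetric) and $\phi_{\mathcal H,M}$ its image under $X\mapsto X_M$, $(P,\Phi)$ is Hamiltonian $G$-quasi Poisson if moreover $[P,P]=\phi_{\mathcal H,M}$ (Schouten bracket, $[X_1\wedge X_2,Y_1\wedge Y_2]=\sum_{i,j}(-1)^{i+j}[X_i,Y_j]\wedge X_{3-i}\wedge Y_{3-j}$, $a\wedge b=a\otimes b-b\otimes a$, and $a\wedge b\wedge c$ the signed sum over all six permutations). $\sigma$ and $P$ are $\Phi$-momentum dual to each other if $\Phi$ is a $G$-momentum mapping for both and $P^\sharp\circ\sigma^\flat=\mathrm{Id}_{\mathrm TM}-\frac14\rho_\Phi$. *)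

(* Defs.v *)
From HB Require Import structures.
From mathcomp Require Import all_boot all_order all_algebra.
From mathcomp Require Import boolp classical_sets reals topology normedtype derive.
From mathcomp Require Import complex.
From mathcomp Require Import -(notations) mpoly.
Set Implicit Arguments.
Unset Strict Implicit.
Unset Printing Implicit Defensive.
Import Order.TTheory GRing.Theory Num.Theory.
Import numFieldNormedType.Exports.
Local Open Scope classical_set_scope.
Local Open Scope ring_scope.

(* An affine variety over K is a Zariski closed subset of K^n = 'rV[K]_n.
   "Regular", "smooth" and "differential" are taken with respect to K, so that
   for K = R[i] smooth means holomorphic.  Maps between varieties, forms and
   tensors are functions defined on all of K^n, but only their values on the
   variety matter. *)

Section AffineVarieties.
Variable K : numFieldType.

Local Notation pol n := (mpoly n K).

Definition ev n (p : pol n) (q : 'rV[K]_n) : K := meval (fun i => q 0 i) p.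

(* formal gradient of a polynomial, evaluated at q *)
Definition pgrad n (p : pol n) (q : 'rV[K]_n) : 'cV[K]_n :=
  \col_i ev (mderiv i p) q.

Definition zariski_closed n (A : set 'rV[K]_n) : Prop :=
  exists S : set (pol n), A = [set q | forall p, S p -> ev p q = 0].

Definition zariski_open n (U : set 'rV[K]_n) : Prop := zariski_closed (~` U).

Definition vanishing_ideal n (A : set 'rV[K]_n) : set (pol n) :=
  [set p | forall q, A q -> ev p q = 0].

Definition tangent n (A : set 'rV[K]_n) (q : 'rV[K]_n) : set 'rV[K]_n :=
  [set v | forall p, vanishing_ideal A p -> v *m pgrad p q = 0].

(* M is smooth at each of its points q: on some principal open neighbourhood {h != 0} of q the
   ideal of M is generated by polynomials f_i with linearly independent
   differentials at q. *)
Definition nonsingular n (M : set 'rV[K]_n) : Prop :=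
  forall q, M q -> exists (r : nat) (f : 'I_r -> pol n) (h : pol n),
    [/\ ev h q <> 0,
        forall i, vanishing_ideal M (f i),
        row_free (\matrix_(i < r) (pgrad (f i) q)^T)
      & forall g, vanishing_ideal M g ->
          exists (N : nat) (c : 'I_r -> pol n),
            h ^+ N * g = \sum_(i < r) c i * f i].

(* f = a / b on a Zariski neighbourhood of q in A *)
Definition quotient_near n (A : set 'rV[K]_n) (f : 'rV[K]_n -> K) q (a b : pol n) :=
  exists U : set 'rV[K]_n,
    [/\ zariski_open U, U q &
        forall p, A p -> U p -> ev b p <> 0 /\ f p = ev a p / ev b p].

Definition regular n (A : set 'rV[K]_n) (f : 'rV[K]_n -> K) : Prop :=
  forall q, A q -> exists a b, quotient_near A f q a b.

Definition regular_map n m (A : set 'rV[K]_n) (f : 'rV[K]_n -> 'rV[K]_m) : Prop :=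
  forall j, regular A (fun p => f p 0 j).

(* Differential at q of a function f regular near q, through the gradient of a
   local expression a / b.  The gradient depends on the choice of a and b, but
   its restriction to the tangent space of A at q does not. *)
Definition rgrad n (A : set 'rV[K]_n) (f : 'rV[K]_n -> K) q : 'cV[K]_n :=
  xget 0 [set D | exists a b, quotient_near A f q a b /\
    D = (ev b q ^+ 2)^-1 *: (ev b q *: pgrad a q - ev a q *: pgrad b q)].

Definition jac n m (A : set 'rV[K]_n) (f : 'rV[K]_n -> 'rV[K]_m) q : 'M[K]_(n, m) :=
  \matrix_(i, j) rgrad A (fun p => f p 0 j) q i 0.

Definition dmap n m (A : set 'rV[K]_n) (f : 'rV[K]_n -> 'rV[K]_m) q v : 'rV[K]_m :=
  v *m jac A f q.

Definition setprod n m (A : set 'rV[K]_n) (B : set 'rV[K]_m) : set 'rV[K]_(n + m) :=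
  [set z | A (lsubmx z) /\ B (rsubmx z)].

(* Smooth functions on open subsets of K^n (Euclidean topology). *)

Definition basis_vec n (i : 'I_n) : 'rV[K]_n := delta_mx 0 i.

Definition partial n (i : 'I_n) (F : 'rV[K]_n -> K) : 'rV[K]_n -> K :=
  fun q => 'D_(basis_vec i) F q.

Definition grad n (F : 'rV[K]_n -> K) (q : 'rV[K]_n) : 'cV[K]_n :=
  \col_i partial i F q.

Fixpoint Ck n (k : nat) (U : set 'rV[K]_n) (F : 'rV[K]_n -> K) : Prop :=
  (forall q, U q -> {for q, continuous F}) /\
  (if k is k'.+1 then
     forall i : 'I_n, (forall q, U q -> derivable F q (basis_vec i)) /\
                      Ck k' U (partial i F)
   else True).

Definition smooth n (U : set 'rV[K]_n) (F : 'rV[K]_n -> K) : Prop :=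
  forall k, Ck k U F.

(* f is smooth near q and the covector c restricts to the differential of f on
   the tangent space of A at q *)
Definition has_differential n (A : set 'rV[K]_n) (f : 'rV[K]_n -> K) q (c : 'cV[K]_n) :=
  exists (U : set 'rV[K]_n) (F : 'rV[K]_n -> K),
    [/\ open U, U q, smooth U F, forall p, A p -> U p -> F p = f p & c = grad F q].

Definition smooth_fun n (A : set 'rV[K]_n) (f : 'rV[K]_n -> K) : Prop :=
  forall q, A q -> exists c, has_differential A f q c.

(* A 2-form s on M is given at q by a matrix, of which only the bilinear form
   (u, v) |-> form_at (s q) u v on the tangent space of M at q matters. *)

Definition form_at n (A : 'M[K]_n) (u v : 'rV[K]_n) : K := (u *m A *m v^T) 0 0.

(* (dx_i /\ dx_j)(u, v) *)
Definition dxdx n (i j : 'I_n) (u v : 'rV[K]_n) : K :=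
  u 0 i * v 0 j - u 0 j * v 0 i.

(* s = \sum_(i, j) c_ij dx_i /\ dx_j on M `&` U *)
Definition form_expr n (M : set 'rV[K]_n) (s : 'rV[K]_n -> 'M[K]_n)
    (U : set 'rV[K]_n) (c : 'I_n -> 'I_n -> 'rV[K]_n -> K) : Prop :=
  forall q u v, M q -> U q -> tangent M q u -> tangent M q v ->
    form_at (s q) u v = \sum_i \sum_j c i j q * dxdx i j u v.

Definition smooth_2form n (M : set 'rV[K]_n) (s : 'rV[K]_n -> 'M[K]_n) : Prop :=
  forall q, M q -> exists U c,
    [/\ open U, U q, forall i j, smooth U (c i j) & form_expr M s U c].

Definition algebraic_2form n (M : set 'rV[K]_n) (s : 'rV[K]_n -> 'M[K]_n) : Prop :=
  forall q, M q -> exists U c,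
    [/\ zariski_open U, U q, forall i j, regular (M `&` U) (c i j)
      & form_expr M s U c].

(* \sum_(i, j) dc_ij /\ dx_i /\ dx_j *)
Definition ext_deriv n (c : 'I_n -> 'I_n -> 'rV[K]_n -> K) (q u v w : 'rV[K]_n) : K :=
  \sum_i \sum_j ((u *m grad (c i j) q) 0 0 * dxdx i j v w
               + (v *m grad (c i j) q) 0 0 * dxdx i j w u
               + (w *m grad (c i j) q) 0 0 * dxdx i j u v).

(* ds = t on M *)
Definition ext_deriv_is n (M : set 'rV[K]_n) (s : 'rV[K]_n -> 'M[K]_n)
    (t : 'rV[K]_n -> 'rV[K]_n -> 'rV[K]_n -> 'rV[K]_n -> K) : Prop :=
  forall U c, open U -> (forall i j, smooth U (c i j)) -> form_expr M s U c ->
  forall q u v w, M q -> U q -> tangent M q u -> tangent M q v -> tangent M q w ->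
    ext_deriv c q u v w = t q u v w.

(* The tensor u (x) v is the matrix u^T *m v, so a skew-symmetric 2-tensor P on
   M is given at q by a skew-symmetric matrix whose rows are tangent to M;
   P(df, dh) = (df)^T *m P q *m dh. *)

Definition tens n (u v : 'rV[K]_n) : 'M[K]_n := u^T *m v.

Definition bivector n (M : set 'rV[K]_n) (P : 'rV[K]_n -> 'M[K]_n) : Prop :=
  forall q, M q -> (P q)^T = - P q /\ forall i, tangent M q (row i (P q)).

(* P^#(c) for a covector c *)
Definition sharp n (P : 'rV[K]_n -> 'M[K]_n) q (c : 'cV[K]_n) : 'rV[K]_n :=
  c^T *m P q.

(* s^b(u) = s(u, .) *)
Definition flat n (s : 'rV[K]_n -> 'M[K]_n) q (u : 'rV[K]_n) : 'cV[K]_n :=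
  (u *m s q)^T.

Definition smooth_ext n (M : set 'rV[K]_n) (P : 'rV[K]_n -> 'M[K]_n)
    (U : set 'rV[K]_n) (Q : 'rV[K]_n -> 'M[K]_n) : Prop :=
  [/\ open U, forall i j, smooth U (fun p => Q p i j)
    & forall p, M p -> U p -> Q p = P p].

Definition smooth_bivector n (M : set 'rV[K]_n) (P : 'rV[K]_n -> 'M[K]_n) : Prop :=
  bivector M P /\ forall q, M q -> exists U Q, U q /\ smooth_ext M P U Q.

Definition algebraic_bivector n (M : set 'rV[K]_n) (P : 'rV[K]_n -> 'M[K]_n) : Prop :=
  bivector M P /\ forall i j, regular M (fun p => P p i j).

Definition vf_bracket n (X Y : 'rV[K]_n -> 'rV[K]_n) (q : 'rV[K]_n) : 'rV[K]_n :=
  \row_k ((X q *m grad (fun p => Y p 0 k) q) 0 0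
        - (Y q *m grad (fun p => X p 0 k) q) 0 0).

(* entries of a /\ b /\ c, the signed sum over all six permutations *)
Definition wedge3 n (a b c : 'rV[K]_n) (i j k : 'I_n) : K :=
  a 0 i * b 0 j * c 0 k + b 0 i * c 0 j * a 0 k + c 0 i * a 0 j * b 0 k
  - b 0 i * a 0 j * c 0 k - a 0 i * c 0 j * b 0 k - c 0 i * b 0 j * a 0 k.

(* entries of [X1 /\ X2, Y1 /\ Y2] *)
Definition schouten_wedge n (X1 X2 Y1 Y2 : 'rV[K]_n -> 'rV[K]_n) q (i j k : 'I_n) : K :=
  wedge3 (vf_bracket X1 Y1 q) (X2 q) (Y2 q) i j k
  - wedge3 (vf_bracket X1 Y2 q) (X2 q) (Y1 q) i j k
  - wedge3 (vf_bracket X2 Y1 q) (X1 q) (Y2 q) i j k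
  + wedge3 (vf_bracket X2 Y2 q) (X1 q) (Y1 q) i j k.

(* entries of [Q, Q] for Q = \sum_(a, b) (Q_ab / 2) D_a /\ D_b, where D_a is the
   a-th coordinate vector field on K^n *)
Definition schouten n (Q : 'rV[K]_n -> 'M[K]_n) q (i j k : 'I_n) : K :=
  \sum_a \sum_b \sum_c \sum_d
    schouten_wedge (fun p => (2^-1 * Q p a b) *: basis_vec a) (fun=> basis_vec b)
                   (fun p => (2^-1 * Q p c d) *: basis_vec c) (fun=> basis_vec d)
                   q i j k.

(* [P, P] = t on M *)
Definition schouten_is n (M : set 'rV[K]_n) (P : 'rV[K]_n -> 'M[K]_n)
    (t : 'rV[K]_n -> 'I_n -> 'I_n -> 'I_n -> K) : Prop :=
  forall U Q, smooth_ext M P U Q ->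
  forall q, M q -> U q -> forall i j k, schouten Q q i j k = t q i j k.

End AffineVarieties.

Record affine_group (K : numFieldType) := AffineGroup {
  gdim : nat;
  gset : set 'rV[K]_gdim;
  gone : 'rV[K]_gdim;
  gmul : 'rV[K]_gdim -> 'rV[K]_gdim -> 'rV[K]_gdim;
  ginv : 'rV[K]_gdim -> 'rV[K]_gdim;
  gset_closed : zariski_closed gset;
  gset_one : gset gone;
  gset_mul : forall g h, gset g -> gset h -> gset (gmul g h);
  gset_inv : forall g, gset g -> gset (ginv g);
  gmulA : forall g h k, gset g -> gset h -> gset k ->
    gmul g (gmul h k) = gmul (gmul g h) k;
  gmul1 : forall g, gset g -> gmul gone g = g;
  gmulV : forall g, gset g -> gmul (ginv g) g = gone;
  gmul_regular : regular_map (setprod gset gset) (fun z => gmul (lsubmx z) (rsubmx z));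
  ginv_regular : regular_map gset ginv
}.

Arguments gset {K} G _ : rename.
Arguments gone {K} G : rename.

Record affine_gvariety (K : numFieldType) (G : affine_group K) := AffineGVariety {
  vdim : nat;
  vset : set 'rV[K]_vdim;
  act : 'rV[K]_(gdim G) -> 'rV[K]_vdim -> 'rV[K]_vdim;
  vset_closed : zariski_closed vset;
  vset_nonsingular : nonsingular vset;
  vset_act : forall g q, gset G g -> vset q -> vset (act g q);
  act1 : forall q, vset q -> act (gone G) q = q;
  actM : forall g h q, gset G g -> gset G h -> vset q ->
    act (gmul g h) q = act g (act h q);
  act_regular : regular_map (setprod (gset G) vset)
    (fun z => act (lsubmx z) (rsubmx z))
}.

Arguments vset {K G} V _ : rename.

Section LieTheory.
Variables (K : numFieldType) (G : affine_group K).
Local Notation vecG := 'rV[K]_(gdim G).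

Definition lie : set vecG := tangent (gset G) (gone G).

(* h X and X h, for X in the Lie algebra; these are X^L(h) and X^R(h) *)
Definition ltrans (h X : vecG) : vecG := dmap (gset G) (fun x => gmul h x) (gone G) X.
Definition rtrans (h X : vecG) : vecG := dmap (gset G) (fun x => gmul x h) (gone G) X.

(* h^-1 v and v h^-1, for v tangent to G at h: the Maurer-Cartan forms, and the
   inverses of ltrans h and rtrans h *)
Definition mcL (h v : vecG) : vecG := dmap (gset G) (fun x => gmul (ginv h) x) h v.
Definition mcR (h v : vecG) : vecG := dmap (gset G) (fun x => gmul x (ginv h)) h v.

Definition Ad (h X : vecG) : vecG :=
  dmap (gset G) (fun x => gmul (gmul h x) (ginv h)) (gone G) X.

(* [X, Y], the value at the identity of the bracket of the vector fields X^L and Y^L *)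
Definition lieb (X Y : vecG) : vecG :=
  dmap (gset G) (fun h => ltrans h Y) (gone G) X
  - dmap (gset G) (fun h => ltrans h X) (gone G) Y.

Definition linear_on (V : set vecG) (xi : vecG -> K) : Prop :=
  forall a X Y, V X -> V Y -> xi (a *: X + Y) = a * xi X + xi Y.

Definition invariant_inner_product (bil : vecG -> vecG -> K) : Prop :=
  [/\ forall X, lie X -> linear_on lie (bil X),
      forall X Y, lie X -> lie Y -> bil X Y = bil Y X,
      forall X, lie X -> (forall Y, lie Y -> bil X Y = 0) -> X = 0
    & forall h X Y, gset G h -> lie X -> lie Y -> bil (Ad h X) (Ad h Y) = bil X Y].

Definition lie_basis r (e : 'I_r -> vecG) : Prop :=
  (forall j, lie (e j)) /\
  forall X, lie X -> exists! a : 'rV[K]_r, X = \sum_j a 0 j *: e j.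

(* The 2-tensor H = \sum_(j, k) eta_jk e_j (x) e_k is given by e and eta. *)

Definition psiH r (e : 'I_r -> vecG) (eta : 'M[K]_r) (xi : vecG -> K) : vecG :=
  \sum_j \sum_k (eta j k * xi (e j)) *: e k.

Definition invariant_symmetric_tensor r (e : 'I_r -> vecG) (eta : 'M[K]_r) : Prop :=
  eta^T = eta /\
  forall h, gset G h ->
    \sum_j \sum_k eta j k *: tens (Ad h (e j)) (Ad h (e k))
    = \sum_j \sum_k eta j k *: tens (e j) (e k).

(* psi^H and X |-> bil X are inverse to each other *)
Definition inverse_tensor (bil : vecG -> vecG -> K) r (e : 'I_r -> vecG)
    (eta : 'M[K]_r) : Prop :=
  (forall X, lie X -> psiH e eta (bil X) = X) /\
  (forall xi Y, linear_on lie xi -> lie Y -> bil (psiH e eta xi) Y = xi Y).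

(* lambda(u, v, w) at h *)
Definition lambda (bil : vecG -> vecG -> K) (h u v w : vecG) : K :=
  2^-1 * bil (lieb (mcL h u) (mcL h v)) (mcL h w).

Variable V : affine_gvariety G.
Local Notation M := (vset V).
Local Notation vecM := 'rV[K]_(vdim V).
Variable Phi : vecM -> vecG.

Definition equivariant_morphism : Prop :=
  [/\ forall q, M q -> gset G (Phi q),
      regular_map M Phi
    & forall g q, gset G g -> M q ->
        Phi (act g q) = gmul (gmul g (Phi q)) (ginv g)].

(* X_M(q), the derivative at t = 0 of exp(-tX) q: as t |-> exp(-tX) has velocity
   -X at the identity, it is the differential of g |-> g q applied to -X *)
Definition fund (X : vecG) (q : vecM) : vecM :=
  dmap (gset G) (fun g => act g q) (gone G) (- X).

Definition rho (q u : vecM) : vecM :=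
  let w := dmap M Phi q u in fund (mcL (Phi q) w - mcR (Phi q) w) q.

Definition invariant_2form (s : vecM -> 'M[K]_(vdim V)) : Prop :=
  forall g q u v, gset G g -> M q -> tangent M q u -> tangent M q v ->
    form_at (s (act g q)) (dmap M (act g) q u) (dmap M (act g) q v) = form_at (s q) u v.

Definition invariant_bivector (P : vecM -> 'M[K]_(vdim V)) : Prop :=
  forall g q, gset G g -> M q ->
    P (act g q) = (jac M (act g) q)^T *m P q *m jac M (act g) q.

Definition form_momentum (bil : vecG -> vecG -> K) (s : vecM -> 'M[K]_(vdim V)) : Prop :=
  forall q v X, M q -> tangent M q v -> lie X ->
    form_at (s q) (fund X q) v
    = 2^-1 * bil X (mcL (Phi q) (dmap M Phi q v) + mcR (Phi q) (dmap M Phi q v)).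

Definition weakly_quasi_hamiltonian (bil : vecG -> vecG -> K)
    (s : vecM -> 'M[K]_(vdim V)) : Prop :=
  [/\ smooth_2form M s, invariant_2form s, form_momentum bil s
    & ext_deriv_is M s (fun q u v w =>
        lambda bil (Phi q) (dmap M Phi q u) (dmap M Phi q v) (dmap M Phi q w))].

Definition Phi_nondegenerate (s : vecM -> 'M[K]_(vdim V)) : Prop :=
  forall q u, M q -> tangent M q u ->
    (forall v, tangent M q v -> form_at (s q) u v = 0) -> dmap M Phi q u = 0 -> u = 0.

Definition poisson_momentum r (e : 'I_r -> vecG) (eta : 'M[K]_r)
    (P : vecM -> 'M[K]_(vdim V)) : Prop :=
  forall f : vecG -> K, smooth_fun (gset G) f ->
  forall q c d, M q -> has_differential M (f \o Phi) q c ->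
    has_differential (gset G) f (Phi q) d ->
    2 *: sharp P q c
    = \sum_j \sum_k (eta j k *
        ((ltrans (Phi q) (e j) + rtrans (Phi q) (e j)) *m d) 0 0) *: fund (e k) q.

(* entries of the image on M of
   phi_H = -1/2 \sum eta_ju eta_vs e_j (x) [e_u, e_v] (x) e_s *)
Definition phi_HM r (e : 'I_r -> vecG) (eta : 'M[K]_r) (q : vecM)
    (a b c : 'I_(vdim V)) : K :=
  - 2^-1 * \sum_j \sum_u \sum_v \sum_s eta j u * eta v s *
    (fund (e j) q 0 a * fund (lieb (e u) (e v)) q 0 b * fund (e s) q 0 c).

Definition hamiltonian_quasi_poisson r (e : 'I_r -> vecG) (eta : 'M[K]_r)
    (P : vecM -> 'M[K]_(vdim V)) : Prop :=
  [/\ smooth_bivector M P, invariant_bivector P, poisson_momentum e eta P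
    & schouten_is M P (phi_HM e eta)].

Definition momentum_dual (bil : vecG -> vecG -> K) r (e : 'I_r -> vecG)
    (eta : 'M[K]_r) (s P : vecM -> 'M[K]_(vdim V)) : Prop :=
  [/\ form_momentum bil s, poisson_momentum e eta P
    & forall q u, M q -> tangent M q u ->
        sharp P q (flat s q u) = u - 4^-1 *: rho q u].

End LieTheory.

(* Main.v *)
Require Import Defs.
From HB Require Import structures.
From mathcomp Require Import all_boot all_order all_algebra.
From mathcomp Require Import boolp classical_sets functions reals topology normedtype derive.
From mathcomp Require Import complex ring.
From mathcomp Require Import -(notations) mpoly.
Import Order.TTheory GRing.Theory Num.Theory.
Import numFieldNormedType.Exports.
Local Open Scope classical_set_scope.
Local Open Scope ring_scope.
Set Implicit Arguments.
Unset Strict Implicit.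

(** Write T for the tangent space of M at a point q.  The duality relation
    P^# o sigma^b = Id - rho/4 together with the two momentum properties makes
    each of sigma and P the solution of a linear system whose coefficients are
    regular functions and the other structure.

    Given sigma, the values of P^# are prescribed on the covectors sigma^b(u)
    (by duality), on the covectors Phi^* d (by the momentum property of P), and
    they vanish on the covectors that annihilate T.  If sigma^b(u) = 0 on T and
    dPhi(u) = 0, then rho(u) = 0 and duality gives u = 0; this is the
    Phi-non-degeneracy of sigma, and as sigma is skew it says that these three
    families of covectors together span all of K^n.  Hence A P = B for matrices
    A and B with regular entries near q, with A of rank n.

    Given P, transposing the duality relation (sigma and P are skew) yields
    sigma(P^# c, v) = c(v - rho(v)/4), while the momentum property of sigma
    prescribes sigma(X_M, v) for X in the Lie algebra.  Duality also writes each
    u in T as P^#(sigma^b u) + rho(u)/4, and rho(u) is the value of a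
    fundamental vector field, so the vectors P^# c and X_M span T.  Again sigma
    is determined by a system of full rank with regular coefficients.

    A system of full rank can be solved regularly near q because a matrix of
    regular functions that is injective at q has a regular left inverse near q
    (regmx_left_inverse).  What remains is to see that the coefficients are
    regular: T is the image of a regular family of projectors
    (tangent_projector), because M is non-singular; and dPhi, the Maurer-Cartan
    forms, the fundamental vector fields and the translations of the Lie
    algebra are partial derivatives of regular maps (regmx_jac,
    regmx_partial_r, regmx_partial_l).  The only analysis needed is for the
    momentum property of P, which quantifies over smooth functions: it is applied
    to the coordinates of G, and one needs that a fraction of polynomials is
    smooth with the expected gradient (frac_has_differential). *)

(** * Polynomials and their gradients *)

Section Polynomials.
Variable K : numFieldType.
Local Notation pol n := (mpoly n K).

Definition pvar n (i : 'I_n) : pol n := mpolyX K (mnm1 i).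

(** Induction along ring operations, the form in which the chain rule and the
    comparison of formal and analytic derivatives are immediate. *)
Lemma mpoly_ring_ind n (Q : pol n -> Prop) :
  (forall c, Q (mpolyC n c)) -> (forall i, Q (pvar i)) ->
  (forall p p', Q p -> Q p' -> Q (p + p')) ->
  (forall p p', Q p -> Q p' -> Q (p * p')) -> forall p, Q p.
Proof.
move=> QC QX QD QM; elim/mpolyind => [|c m p _ _ Qp]; first by rewrite -mpolyC0.
apply: (QD) => //; rewrite -mul_mpolyC; apply: (QM) => //.
rewrite mpolyXE_id; apply: big_ind => [||i _]; [exact: (QC)|exact: QM|].
by elim: (m i) => [|k Qk]; rewrite ?exprS; [exact: (QC) | exact: (QM) (QX i) Qk].
Qed.

Lemma evC n c (q : 'rV[K]_n) : ev (mpolyC n c) q = c.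
Proof. exact: mevalC. Qed.

Lemma evX n i (q : 'rV[K]_n) : ev (pvar i) q = q 0 i.
Proof. exact: mevalXU. Qed.

Lemma ev0 n (q : 'rV[K]_n) : ev 0 q = 0.
Proof. exact: meval0. Qed.

Lemma ev1 n (q : 'rV[K]_n) : ev 1 q = 1.
Proof. exact: meval1. Qed.

Lemma evD n (a b : pol n) q : ev (a + b) q = ev a q + ev b q.
Proof. exact: mevalD. Qed.

Lemma evB n (a b : pol n) q : ev (a - b) q = ev a q - ev b q.
Proof. exact: mevalB. Qed.

Lemma evM n (a b : pol n) q : ev (a * b) q = ev a q * ev b q.
Proof. exact: mevalM. Qed.

Lemma pgradC n c (q : 'rV[K]_n) : pgrad (mpolyC n c) q = 0.
Proof. by apply/colP => i; rewrite !mxE mderivC ev0. Qed.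

Lemma pgrad1 n (q : 'rV[K]_n) : pgrad 1 q = 0.
Proof. by rewrite -mpolyC1 pgradC. Qed.

Lemma pgradX n j (q : 'rV[K]_n) : pgrad (pvar j) q = delta_mx j 0.
Proof.
apply/colP => i; rewrite !mxE mderivX mnm1E eqxx andbT /ev mevalZ mevalX.
case: eqVneq => [->|]; last by rewrite mul0r.
by rewrite big1 ?mulr1 // => k _; rewrite mnmBE subnn.
Qed.

Lemma pgradD n (a b : pol n) q : pgrad (a + b) q = pgrad a q + pgrad b q.
Proof. by apply/colP => i; rewrite !mxE mderivD evD. Qed.

Lemma pgradB n (a b : pol n) q : pgrad (a - b) q = pgrad a q - pgrad b q.
Proof. by apply/colP => i; rewrite !mxE mderivB evB. Qed.

Lemma pgradM n (a b : pol n) q :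
  pgrad (a * b) q = ev b q *: pgrad a q + ev a q *: pgrad b q.
Proof.
by apply/colP => i; rewrite !mxE mderivM evD !evM mulrC.
Qed.

End Polynomials.

(** * Germs of regular functions and their derivatives along vectors *)

Section Germs.
Variable K : numFieldType.
Local Notation pol n := (mpoly n K).

(** Neighbourhoods of q in A for the Zariski topology; those cut out by a single
    polynomial form a base, and they carry the local fractions below. *)
Definition znbhs n (A : set 'rV[K]_n) (q : 'rV[K]_n) : set_system 'rV[K]_n :=
  [set S | exists2 b : pol n, ev b q != 0 & forall p, A p -> ev b p != 0 -> S p].

Global Instance znbhs_filter n (A : set 'rV[K]_n) q : Filter (znbhs A q).
Proof.
split=> [|S T [a aq aS] [b bq bT]|S T ST [b bq bS]].
- by exists 1; rewrite ?ev1 ?oner_neq0.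
- exists (a * b); first by rewrite evM mulf_neq0.
  by move=> p Ap; rewrite evM mulf_eq0 => /norP[ap bp]; split; [exact: aS | exact: bT].
- by exists b => // p Ap bp; apply: ST; exact: bS.
Qed.

Lemma znbhs_base n (A : set 'rV[K]_n) q : znbhs A q A.
Proof. by exists 1; rewrite ?ev1 ?oner_neq0. Qed.

Lemma znbhsI n (A : set 'rV[K]_n) q (S T : set 'rV[K]_n) :
  znbhs A q S -> znbhs A q T -> znbhs A q (fun p => S p /\ T p).
Proof. exact: filterI. Qed.

Lemma znbhs_forall n (A : set 'rV[K]_n) q (I : finType) (S : I -> set 'rV[K]_n) :
  (forall i, znbhs A q (S i)) -> znbhs A q (fun p => forall i, S i p).
Proof. exact: (@filter_forall _ _ S _ (znbhs_filter A q)). Qed.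

Lemma znbhs_point n (A : set 'rV[K]_n) q S : A q -> znbhs A q S -> S q.
Proof. by move=> Aq [b bq bS]; exact: bS. Qed.

Lemma principal_open n (b : pol n) : zariski_open [set p | ev b p <> 0].
Proof.
exists [set b]; apply/seteqP; split=> [p bp c -> | p bp bp0].
  by apply: contrapT => /eqP bp0; apply: bp; exact/eqP.
exact/bp0/bp.
Qed.

Lemma zariski_open_nbhs n (A U : set 'rV[K]_n) q : zariski_open U -> U q -> znbhs A q U.
Proof.
move=> [S SU] Uq.
have /existsNP[b] : ~ (forall p, S p -> ev p q = 0).
  by move=> Sq; have : (~` U) q by rewrite SU.
move=> /not_implyP[Sb /eqP bq]; exists b => // p _ bp.
apply: contrapT => nUp; have : (~` U) p by [].
by rewrite SU => /(_ _ Sb) bp0; rewrite bp0 eqxx in bp.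
Qed.

(** The denominator itself cuts out the neighbourhood on which the fraction
    represents f.  No generality is lost: multiplying a and b by a polynomial h
    shrinks the neighbourhood and, by [qgrad_scale], keeps the derivatives. *)
Definition frac_at n (A : set 'rV[K]_n) (f : 'rV[K]_n -> K) q (a b : pol n) :=
  ev b q != 0 /\ forall p, A p -> ev b p != 0 -> f p = ev a p / ev b p.

(** The gradient of a / b by the quotient rule. *)
Definition qgrad n (a b : pol n) (q : 'rV[K]_n) : 'cV[K]_n :=
  (ev b q ^+ 2)^-1 *: (ev b q *: pgrad a q - ev a q *: pgrad b q).

Definition reg_at n (A : set 'rV[K]_n) f q := exists a b, frac_at A f q a b.

(** The derivative of f at q along v.  As a relation it records the germ of f at
    the same time, so the rules of differentiation below give the stability of
    regular functions under the corresponding operations. *)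
Definition dirder n (A : set 'rV[K]_n) f q (v : 'rV[K]_n) (c : K) :=
  exists a b, frac_at A f q a b /\ (v *m qgrad a b q) 0 0 = c.

Lemma reg_dirder n (A : set 'rV[K]_n) f q v : reg_at A f q <-> exists c, dirder A f q v c.
Proof.
split=> [[a [b fab]]|[c [a [b [fab _]]]]]; last by exists a, b.
by exists ((v *m qgrad a b q) 0 0), a, b.
Qed.

Definition pder n (v : 'rV[K]_n) (p : pol n) q := (v *m pgrad p q) 0 0.

Lemma pderM n v (a b : pol n) q :
  pder v (a * b) q = ev b q * pder v a q + ev a q * pder v b q.
Proof. by rewrite /pder pgradM mulmxDr -!scalemxAr !mxE. Qed.

Lemma pderD n v (a b : pol n) q : pder v (a + b) q = pder v a q + pder v b q.
Proof. by rewrite /pder pgradD mulmxDr !mxE. Qed.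

Lemma pderB n v (a b : pol n) q : pder v (a - b) q = pder v a q - pder v b q.
Proof. by rewrite /pder pgradB mulmxBr !mxE. Qed.

Lemma qgradE n (v : 'rV[K]_n) (a b : pol n) q :
  (v *m qgrad a b q) 0 0
  = (ev b q ^+ 2)^-1 * (ev b q * pder v a q - ev a q * pder v b q).
Proof. by rewrite /qgrad /pder -scalemxAr mulmxBr -!scalemxAr !mxE. Qed.

Lemma qgrad_scale n (v : 'rV[K]_n) (a b h : pol n) q : ev b q != 0 -> ev h q != 0 ->
  (v *m qgrad (a * h) (b * h) q) 0 0 = (v *m qgrad a b q) 0 0.
Proof. by move=> bq hq; rewrite !qgradE !pderM !evM; field; rewrite bq hq. Qed.

Lemma frac_near n (A : set 'rV[K]_n) f q a b : frac_at A f q a b ->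
  znbhs A q (fun p => frac_at A f p a b).
Proof. by move=> [bq fab]; exists b => // p Ap bp; split. Qed.

Lemma frac_quotient n (A : set 'rV[K]_n) f q a b :
  frac_at A f q a b -> quotient_near A f q a b.
Proof.
move=> [bq fab]; exists [set p | ev b p <> 0]; split; first exact: principal_open.
  by move/eqP: bq.
by move=> p Ap /eqP bp; split; [exact/eqP | exact: fab].
Qed.

Lemma quotient_frac n (A : set 'rV[K]_n) f q a b : A q -> quotient_near A f q a b ->
  exists2 h, ev h q != 0 & ev b q != 0 /\ frac_at A f q (a * h) (b * h).
Proof.
move=> Aq [U [Uo Uq Uab]]; have [h hq hU] := zariski_open_nbhs A Uo Uq.
have bq : ev b q != 0 by apply/eqP; case: (Uab q).
exists h => //; split=> //; split=> [|p Ap]; first by rewrite evM mulf_neq0.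
rewrite !evM mulf_eq0 => /norP[bp hp].
by have [_ ->] := Uab p Ap (hU p Ap hp); field; rewrite bp hp.
Qed.

Lemma frac_congr n (A : set 'rV[K]_n) f g q a b h : ev h q != 0 ->
  (forall p, A p -> ev h p != 0 -> f p = g p) ->
  frac_at A g q a b -> frac_at A f q (a * h) (b * h).
Proof.
move=> hq fg [bq gab]; split=> [|p Ap]; rewrite !evM; first exact: mulf_neq0.
rewrite mulf_eq0 => /norP[bp hp].
by rewrite fg // gab //; field; rewrite bp hp.
Qed.

(** The cross difference a b' - a' b of two fractions for f vanishes on A once it
    is multiplied by both denominators, so v kills the gradient of that product;
    by the quotient rule this is the equality of the two derivatives. *)
Lemma frac_uniq n (A : set 'rV[K]_n) f q (v : 'rV[K]_n) a b a' b' : A q -> tangent A q v ->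
  frac_at A f q a b -> frac_at A f q a' b' ->
  (v *m qgrad a b q) 0 0 = (v *m qgrad a' b' q) 0 0.
Proof.
move=> Aq vq [bq fab] [bq' fab'].
(* the factor b * b' makes the numerator vanish also where a denominator does *)
have gA : vanishing_ideal A ((a * b' - a' * b) * (b * b')).
  move=> p Ap; rewrite !(evM, evB).
  have [->|bp] := eqVneq (ev b p) 0; first by rewrite mul0r mulr0.
  have [->|bp'] := eqVneq (ev b' p) 0; first by rewrite !mulr0.
  have := fab p Ap bp; rewrite fab' // => e.
  have -> : ev a p = ev a' p / ev b' p * ev b p by rewrite e; field.
  by field.
have aE : ev a q = f q * ev b q by rewrite fab //; field.
have aE' : ev a' q = f q * ev b' q by rewrite fab' //; field.
have := vq _ gA => /(congr1 (fun X : 'M_1 => X 0 0)).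
rewrite -[LHS]/(pder _ _ _) !(pderM, pderB, evM, evB) mxE aE aE' !qgradE aE aE'.
set da := pder v a q; set db := pder v b q; set da' := pder v a' q.
set db' := pder v b' q => e.
have {}e : (da - f q * db) * ev b' q = (da' - f q * db') * ev b q.
  apply: (mulfI (mulf_neq0 bq bq')); apply/eqP; rewrite -subr_eq0 -[X in _ == X]e.
  by apply/eqP; ring.
have -> : da = (da' - f q * db') * ev b q / ev b' q + f q * db.
  by rewrite -e; field.
by field; rewrite bq bq'.
Qed.

Lemma dirder_uniq n (A : set 'rV[K]_n) f q v c c' : A q -> tangent A q v ->
  dirder A f q v c -> dirder A f q v c' -> c = c'.
Proof. by move=> Aq vq [a [b [ab <-]]] [a' [b' [ab' <-]]]; exact: frac_uniq ab ab'. Qed.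

Lemma regularE n (A : set 'rV[K]_n) f : regular A f <-> forall q, A q -> reg_at A f q.
Proof.
split=> rf q Aq.
  have [a [b ab]] := rf q Aq; have [h hq [_ fab]] := quotient_frac Aq ab.
  by exists (a * h), (b * h).
by have [a [b ab]] := rf q Aq; exists a, b; exact: frac_quotient.
Qed.

Lemma rgradE n (A : set 'rV[K]_n) f q (v : 'rV[K]_n) c : A q -> tangent A q v ->
  dirder A f q v c -> (v *m rgrad A f q) 0 0 = c.
Proof.
move=> Aq vq [a [b [fab <-]]]; rewrite /rgrad.
case: xgetP => [D _ [a' [b' [ab' ->]]]|/(_ (qgrad a b q))[]]; last first.
  by exists a, b; split=> //; exact: frac_quotient.
have [h hq [bq' hab']] := quotient_frac Aq ab'.
by rewrite -/(qgrad a' b' q) -(qgrad_scale _ _ bq' hq); exact: frac_uniq hab' fab.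
Qed.

Lemma dirder_congr n (A : set 'rV[K]_n) f g q v c : znbhs A q (fun p => f p = g p) ->
  dirder A g q v c -> dirder A f q v c.
Proof.
move=> [h hq fg] [a [b [gab <-]]]; exists (a * h), (b * h); split.
  exact: (frac_congr hq fg gab).
by rewrite qgrad_scale //; case: gab.
Qed.

Lemma dirder_poly n (A : set 'rV[K]_n) (p : pol n) q v : dirder A (ev p) q v (pder v p q).
Proof.
exists p, 1; split; first by split=> [|x _ _]; rewrite ev1 ?oner_neq0 ?divr1.
have p1 : pder v 1 q = 0 by rewrite /pder pgrad1 mulmx0 mxE.
by rewrite qgradE ev1 p1; field.
Qed.

Lemma dirder_cst n (A : set 'rV[K]_n) c q v : dirder A (fun=> c) q v 0.
Proof.
have := dirder_poly A (mpolyC n c) q v; rewrite /pder pgradC mulmx0 mxE.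
by apply: dirder_congr; apply: filterE => p; rewrite evC.
Qed.

Lemma dirder_coord n (A : set 'rV[K]_n) j q v : dirder A (fun p => p 0 j) q v (v 0 j).
Proof.
have := dirder_poly A (pvar K j) q v; rewrite /pder pgradX -colE mxE.
by apply: dirder_congr; apply: filterE => p; rewrite evX.
Qed.

Section Operations.
Variables (n : nat) (A : set 'rV[K]_n) (q v : 'rV[K]_n).
Hypothesis Aq : A q.

Lemma dirderD f g c d : dirder A f q v c -> dirder A g q v d ->
  dirder A (fun p => f p + g p) q v (c + d).
Proof.
move=> [a [b [[bq fab] <-]]] [a' [b' [[bq' gab] <-]]].
exists (a * b' + a' * b), (b * b'); split; last first.
  by rewrite !qgradE !(pderD, pderM, evM, evD); field; rewrite bq bq'.
split=> [|p Ap]; rewrite !(evM, evD); first exact: mulf_neq0.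
rewrite mulf_eq0 => /norP[bp bp'].
by rewrite fab // gab //; field; rewrite bp bp'.
Qed.

Lemma dirderM f g c d : dirder A f q v c -> dirder A g q v d ->
  dirder A (fun p => f p * g p) q v (f q * d + g q * c).
Proof.
move=> [a [b [[bq fab] <-]]] [a' [b' [[bq' gab] <-]]].
exists (a * a'), (b * b'); split; last first.
  by rewrite fab // gab // !qgradE !(pderM, evM); field; rewrite bq bq'.
split=> [|p Ap]; rewrite !evM; first exact: mulf_neq0.
rewrite mulf_eq0 => /norP[bp bp'].
by rewrite fab // gab //; field; rewrite bp bp'.
Qed.

Lemma dirderV f c : f q != 0 -> dirder A f q v c ->
  dirder A (fun p => (f p)^-1) q v (- c / f q ^+ 2).
Proof.
move=> fq [a [b [[bq fab] <-]]].
have aq : ev a q != 0 by apply: contra_neq fq => aq; rewrite fab // aq mul0r.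
exists (b * b), (a * b); split; last first.
  by rewrite fab // !qgradE !(pderM, evM); field; rewrite bq aq.
split=> [|p Ap]; rewrite !evM; first exact: mulf_neq0.
rewrite mulf_eq0 => /norP[ap bp].
by rewrite fab //; field; rewrite bp ap.
Qed.

Variables (m : nat) (F : 'rV[K]_n -> 'rV[K]_m) (w : 'rV[K]_m).
Hypothesis Fw : forall j, dirder A (fun p => F p 0 j) q v (w 0 j).

Lemma dirder_ev_comp (p : pol m) : dirder A (fun x => ev p (F x)) q v (pder w p (F q)).
Proof.
elim/mpoly_ring_ind: p => [c|i|p p' IHp IHp'|p p' IHp IHp'].
- rewrite /pder pgradC mulmx0 mxE.
  by apply: dirder_congr (dirder_cst A c q v); apply: filterE => x; rewrite evC.
- rewrite /pder pgradX -colE mxE.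
  by apply: dirder_congr (Fw i); apply: filterE => x; rewrite evX.
- rewrite pderD; apply: dirder_congr (dirderD IHp IHp').
  by apply: filterE => x; rewrite evD.
- rewrite pderM addrC; apply: dirder_congr (dirderM IHp IHp').
  by apply: filterE => x; rewrite evM.
Qed.

(** The chain rule.  The fraction for f may be substituted only where its
    denominator does not vanish at F p, which is a neighbourhood of q as the
    denominator composed with F is regular and nonzero at q. *)
Lemma dirder_comp (B : set 'rV[K]_m) f a b : (forall p, A p -> B (F p)) ->
  frac_at B f (F q) a b -> dirder A (fun p => f (F p)) q v ((w *m qgrad a b (F q)) 0 0).
Proof.
move=> AB [bq fab].
have [c [d [[dq cd] _]]] := dirder_ev_comp b.
have bF : znbhs A q (fun p => ev b (F p) != 0).
  exists (c * d).
    by rewrite evM mulf_neq0 //; apply: contra_neq bq => c0; rewrite cd // c0 mul0r.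
  move=> p Ap; rewrite evM mulf_eq0 => /norP[cp dp].
  by rewrite cd // mulf_neq0 ?invr_neq0.
have -> : (w *m qgrad a b (F q)) 0 0 =
    ev a (F q) * (- pder w b (F q) / ev b (F q) ^+ 2)
    + (ev b (F q))^-1 * pder w a (F q).
  by rewrite qgradE; field.
apply: dirder_congr (dirderM (dirder_ev_comp a) (dirderV bq (dirder_ev_comp b))).
apply: filterS2 bF (znbhs_base A q) => p bp Ap.
by apply: fab => //; exact: AB.
Qed.

End Operations.

Section RegularOperations.
Variables (n : nat) (A : set 'rV[K]_n) (q : 'rV[K]_n).
Hypothesis Aq : A q.

Lemma reg_congr f g : znbhs A q (fun p => f p = g p) -> reg_at A g q -> reg_at A f q.
Proof.
move=> fg /(reg_dirder A g q 0)[c gc]; apply/(reg_dirder A f q 0).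
by exists c; exact: dirder_congr gc.
Qed.

Lemma reg_cst c : reg_at A (fun=> c) q.
Proof. by apply/(reg_dirder A _ q 0); exists 0; exact: dirder_cst. Qed.

Lemma reg_coord j : reg_at A (fun p => p 0 j) q.
Proof. by apply/(reg_dirder A _ q 0); eexists; exact: dirder_coord. Qed.

Lemma regD f g : reg_at A f q -> reg_at A g q -> reg_at A (fun p => f p + g p) q.
Proof.
move=> /(reg_dirder A f q 0)[c fc] /(reg_dirder A g q 0)[d gd].
by apply/(reg_dirder A _ q 0); exists (c + d); exact: dirderD.
Qed.

Lemma regM f g : reg_at A f q -> reg_at A g q -> reg_at A (fun p => f p * g p) q.
Proof.
move=> /(reg_dirder A f q 0)[c fc] /(reg_dirder A g q 0)[d gd].
by apply/(reg_dirder A _ q 0); eexists; exact: dirderM fc gd.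
Qed.

Lemma regV f : f q != 0 -> reg_at A f q -> reg_at A (fun p => (f p)^-1) q.
Proof.
move=> fq /(reg_dirder A f q 0)[c fc].
by apply/(reg_dirder A _ q 0); eexists; exact: dirderV fc.
Qed.

Lemma reg_sum I (s : seq I) (Q : pred I) (f : I -> 'rV[K]_n -> K) :
  (forall i, reg_at A (f i) q) -> reg_at A (fun p => \sum_(i <- s | Q i) f i p) q.
Proof.
move=> fr; elim: s => [|i s IHs].
  by apply: reg_congr (reg_cst 0); apply: filterE => p; rewrite big_nil.
apply: (@reg_congr _ (fun p => (if Q i then f i p else 0) + \sum_(i <- s | Q i) f i p)).
  by apply: filterE => p; rewrite big_cons; case: ifP; rewrite ?add0r.
by apply: regD => //; case: (Q i) => //; exact: reg_cst.
Qed.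

Lemma reg_prod I (s : seq I) (Q : pred I) (f : I -> 'rV[K]_n -> K) :
  (forall i, reg_at A (f i) q) -> reg_at A (fun p => \prod_(i <- s | Q i) f i p) q.
Proof.
move=> fr; elim: s => [|i s IHs].
  by apply: reg_congr (reg_cst 1); apply: filterE => p; rewrite big_nil.
apply: (@reg_congr _ (fun p => (if Q i then f i p else 1) * \prod_(i <- s | Q i) f i p)).
  by apply: filterE => p; rewrite big_cons; case: ifP; rewrite ?mul1r.
by apply: regM => //; case: (Q i) => //; exact: reg_cst.
Qed.

End RegularOperations.

End Germs.

(** * Fractions of polynomials are smooth *)

Section Smoothness.
Variable K : numFieldType.
Local Notation pol n := (mpoly n K).

Lemma is_derive_coord n (q v : 'rV[K]_n) j :
  is_derive q v (fun p : 'rV[K]_n => p 0 j : K) (v 0 j).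
Proof.
pose f (p : 'rV[K]_n) : K := p 0 j.
have lin : linear f by move=> c x y; rewrite /f !mxE.
pose L : {linear 'rV[K]_n -> K} := HB.pack f (GRing.isLinear.Build _ _ _ _ _ lin).
have df : differentiable (fun p : 'rV[K]_n => p 0 j) q by exact: differentiable_coord.
apply: DeriveDef; first exact: diff_derivable.
by rewrite deriveE // (@diff_lin _ _ _ L) //; exact: coord_continuous.
Qed.

Lemma ev_differentiable n (p : pol n) (q : 'rV[K]_n) :
  differentiable (ev p) q /\ forall v, is_derive q v (ev p) (pder v p q).
Proof.
elim/mpoly_ring_ind: p => [c|i|p p' [dp IHp] [dp' IHp']|p p' [dp IHp] [dp' IHp']].
- have -> : ev (mpolyC n c) = (fun=> c) by apply/funext => x; rewrite evC.
  split=> [|v]; first exact: differentiable_cst.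
  by rewrite /pder pgradC mulmx0 mxE; exact: is_derive_cst.
- have -> : ev (pvar K i) = fun x => x 0 i by apply/funext => x; rewrite evX.
  split=> [|v]; first exact: differentiable_coord.
  by rewrite /pder pgradX -colE mxE; exact: is_derive_coord.
- have -> : ev (p + p') = ev p + ev p' by apply/funext => x; rewrite evD.
  split=> [|v]; first exact: differentiableD.
  by rewrite pderD; exact: is_deriveD.
- have -> : ev (p * p') = ev p * ev p' by apply/funext => x; rewrite evM.
  split=> [|v]; first exact: differentiableM.
  by rewrite pderM addrC; exact: is_deriveM.
Qed.

Lemma frac_differentiable n (a b : pol n) (q : 'rV[K]_n) : ev b q != 0 ->
  differentiable (fun p => ev a p / ev b p) q /\
  forall v, is_derive q v (fun p => ev a p / ev b p) ((v *m qgrad a b q) 0 0).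
Proof.
move=> bq; have [da ha] := ev_differentiable a q.
have [db hb] := ev_differentiable b q.
split=> [|v].
  exact: (@differentiableM _ _ (ev a) (fun p => (ev b p)^-1) q da (differentiableV db bq)).
have dV : is_derive q v (fun p => (ev b p)^-1) (- (ev b q) ^- 2 *: pder v b q).
  have [h1 h2] := hb v; apply: DeriveDef; first exact: derivableV.
  by rewrite deriveV // h2.
apply: (is_derive_eq (is_deriveM (ha v) dV)).
rewrite qgradE.
set a' := pder v a q; set b' := pder v b q.
rewrite -[LHS]/(ev a q * (- (ev b q) ^- 2 * b') + (ev b q)^-1 * a').
by field.
Qed.

Lemma open_principal n (b : pol n) : open [set p : 'rV[K]_n | ev b p != 0].
Proof.
rewrite openE => q /= bq; rewrite /interior.
have cb : {for q, continuous (ev b)}.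
  by apply: differentiable_continuous; case: (ev_differentiable b q).
exact: (cvgr_neq0 (ev b q) cb bq).
Qed.

(** F is only known on U: a quotient of polynomials has junk values where the
    denominator vanishes, and so do its iterated partial derivatives. *)
Lemma frac_on_open n (U : set 'rV[K]_n) F (a b : pol n) : open U ->
  (forall p, U p -> ev b p != 0) -> (forall p, U p -> F p = ev a p / ev b p) ->
  forall q, U q -> {for q, continuous F} /\
    forall v, is_derive q v F ((v *m qgrad a b q) 0 0).
Proof.
move=> Uo Ub UF q Uq; have [c d] := frac_differentiable a (Ub q Uq).
have Fnear : \near q, ev a q / ev b q = F q.
  by apply: filterS (open_nbhs_nbhs (conj Uo Uq)) => p /UF ->.
split=> [|v]; last exact: near_eq_is_derive Fnear (d v).
have {}c := differentiable_continuous c.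
rewrite /prop_for /continuous_at UF //; apply: cvg_trans c.
exact: (near_eq_cvg Fnear).
Qed.

(** The partial derivatives are again fractions of polynomials on U, with the
    squared denominator, so the induction runs over all numerators and
    denominators at once. *)
Lemma frac_Ck n k (U : set 'rV[K]_n) F (a b : pol n) : open U ->
  (forall p, U p -> ev b p != 0) -> (forall p, U p -> F p = ev a p / ev b p) -> Ck k U F.
Proof.
move=> Uo; elim: k F a b => [|k IHk] F a b Ub UF.
  by split=> // q Uq; have [] := frac_on_open Uo Ub UF Uq.
split=> [q Uq|i]; first by have [] := frac_on_open Uo Ub UF Uq.
have Fd q : U q -> is_derive q (basis_vec K i) F ((basis_vec K i *m qgrad a b q) 0 0).
  by move=> Uq; have [_] := frac_on_open Uo Ub UF Uq.
split=> [q /Fd[]//|].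
apply: (IHk _ (mderiv i a * b - a * mderiv i b) (b * b)) => p Up.
  by rewrite evM mulf_neq0 // Ub.
have [_] := Fd p Up; rewrite /partial => ->.
by rewrite -rowE !mxE !(evM, evB); field; exact: Ub.
Qed.

Lemma frac_has_differential n (A : set 'rV[K]_n) f q a b :
  frac_at A f q a b -> has_differential A f q (qgrad a b q).
Proof.
move=> [bq fab].
exists [set p | ev b p != 0], (fun p => ev a p / ev b p); split=> //.
- exact: open_principal.
- move=> k; apply: (@frac_Ck _ _ _ _ a b) => //; exact: open_principal.
- by move=> p Ap bp; rewrite fab.
- apply/colP => i; rewrite [RHS]mxE /partial.
  have [_ /(_ (basis_vec K i)) [_ ->]] := frac_differentiable a bq.
  by rewrite -rowE [RHS]mxE.
Qed.

Lemma coord_has_differential n (A : set 'rV[K]_n) j q :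
  has_differential A (fun p => p 0 j) q (delta_mx j 0).
Proof.
have fr : frac_at A (fun p => p 0 j) q (pvar K j) 1.
  by split=> [|p _ _]; rewrite ev1 ?oner_neq0 // evX divr1.
have := frac_has_differential fr.
have -> : qgrad (pvar K j) 1 q = delta_mx j 0; last by [].
by rewrite /qgrad ev1 pgrad1 scaler0 subr0 pgradX expr1n invr1 !scale1r.
Qed.

End Smoothness.

(** * Matrices of regular functions and Jacobians *)

Section RegularMatrices.
Variable K : numFieldType.

Definition regmx n (A : set 'rV[K]_n) k l (F : 'rV[K]_n -> 'M[K]_(k, l)) q :=
  forall i j, reg_at A (fun p => F p i j) q.

Section AtPoint.
Variables (n : nat) (A : set 'rV[K]_n) (q : 'rV[K]_n).
Hypothesis Aq : A q.

Lemma regmx_congr k l (F G : 'rV[K]_n -> 'M[K]_(k, l)) :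
  znbhs A q (fun p => F p = G p) -> regmx A G q -> regmx A F q.
Proof.
by move=> FG rG i j; apply: reg_congr (rG i j); apply: filterS FG => p ->.
Qed.

Lemma regmx_cst k l (C : 'M[K]_(k, l)) : regmx A (fun=> C) q.
Proof. by move=> i j; exact: reg_cst. Qed.

Lemma regmxD k l (F G : 'rV[K]_n -> 'M[K]_(k, l)) :
  regmx A F q -> regmx A G q -> regmx A (fun p => F p + G p) q.
Proof.
move=> rF rG i j; apply: reg_congr (regD (rF i j) (rG i j)).
by apply: filterE => p; rewrite mxE.
Qed.

Lemma regmxM k l m (F : 'rV[K]_n -> 'M[K]_(k, l)) (G : 'rV[K]_n -> 'M[K]_(l, m)) :
  regmx A F q -> regmx A G q -> regmx A (fun p => F p *m G p) q.
Proof.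
move=> rF rG i j.
have r : forall h : 'I_l, reg_at A (fun p => F p i h * G p h j) q.
  by move=> h; exact: regM.
apply: (@reg_congr _ _ A q _ (fun p => \sum_h F p i h * G p h j)).
  by apply: filterE => p; rewrite mxE.
exact: (reg_sum _ _ r).
Qed.

Lemma regmxZ k l c (F : 'rV[K]_n -> 'M[K]_(k, l)) :
  regmx A F q -> regmx A (fun p => c *: F p) q.
Proof.
move=> rF; apply: regmx_congr (regmxM (regmx_cst c%:M) rF).
by apply: filterE => p; rewrite mul_scalar_mx.
Qed.

Lemma regmxB k l (F G : 'rV[K]_n -> 'M[K]_(k, l)) :
  regmx A F q -> regmx A G q -> regmx A (fun p => F p - G p) q.
Proof.
move=> rF rG; apply: regmx_congr (regmxD rF (regmxZ (- 1) rG)).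
by apply: filterE => p; rewrite scaleN1r.
Qed.

Lemma regmxT k l (F : 'rV[K]_n -> 'M[K]_(k, l)) :
  regmx A F q -> regmx A (fun p => (F p)^T) q.
Proof.
by move=> rF i j; apply: reg_congr (rF j i); apply: filterE => p; rewrite mxE.
Qed.

Lemma regmx_col k1 k2 l (F : 'rV[K]_n -> 'M[K]_(k1, l)) (G : 'rV[K]_n -> 'M[K]_(k2, l)) :
  regmx A F q -> regmx A G q -> regmx A (fun p => col_mx (F p) (G p)) q.
Proof.
move=> rF rG i j; rewrite -(splitK i); case: (fintype.split i) => i' /=.
  by apply: reg_congr (rF i' j); apply: filterE => p; rewrite col_mxEu.
by apply: reg_congr (rG i' j); apply: filterE => p; rewrite col_mxEd.
Qed.

Lemma regmx_row k l1 l2 (F : 'rV[K]_n -> 'M[K]_(k, l1)) (G : 'rV[K]_n -> 'M[K]_(k, l2)) :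
  regmx A F q -> regmx A G q -> regmx A (fun p => row_mx (F p) (G p)) q.
Proof.
move=> rF rG; apply: regmx_congr (regmxT (regmx_col (regmxT rF) (regmxT rG))).
by apply: filterE => p; rewrite tr_col_mx !trmxK.
Qed.

Lemma regmx_lsub k l1 l2 (F : 'rV[K]_n -> 'M[K]_(k, l1 + l2)) :
  regmx A F q -> regmx A (fun p => lsubmx (F p)) q.
Proof.
by move=> rF i j; apply: reg_congr (rF i (lshift l2 j)); apply: filterE => p; rewrite mxE.
Qed.

Lemma regmx_rsub k l1 l2 (F : 'rV[K]_n -> 'M[K]_(k, l1 + l2)) :
  regmx A F q -> regmx A (fun p => rsubmx (F p)) q.
Proof.
by move=> rF i j; apply: reg_congr (rF i (rshift l1 j)); apply: filterE => p; rewrite mxE.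
Qed.

Lemma regmx_id : regmx A id q.
Proof. by move=> i j; rewrite ord1; exact: reg_coord. Qed.

Lemma reg_det k (F : 'rV[K]_n -> 'M[K]_k) :
  regmx A F q -> reg_at A (fun p => \det (F p)) q.
Proof.
move=> rF; apply: reg_sum => s.
apply: regM => //; first exact: reg_cst.
exact: reg_prod.
Qed.

Lemma regmx_inv k (F : 'rV[K]_n -> 'M[K]_k) : regmx A F q -> F q \in unitmx ->
  regmx A (fun p => invmx (F p)) q /\ znbhs A q (fun p => F p \in unitmx).
Proof.
move=> rF uq; have dq : \det (F q) != 0 by move: uq; rewrite unitmxE unitfE.
have rd := reg_det rF; have [a [b [bq dab]]] := rd.
have aq : ev a q != 0.
  by apply: contra_neq dq => aq; rewrite dab // aq mul0r.
have un : znbhs A q (fun p => F p \in unitmx).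
  exists (a * b); first by rewrite evM mulf_neq0.
  move=> p Ap; rewrite evM mulf_eq0 => /norP[ap bp].
  by rewrite unitmxE unitfE dab // mulf_neq0 ?invr_neq0.
split=> // i j.
apply: (@reg_congr _ _ _ _ _ (fun p => (\det (F p))^-1 * cofactor (F p) j i)).
  by apply: filterS un => p up; rewrite /invmx up !mxE.
apply: regM => //; first exact: regV.
apply: regM => //; first exact: reg_cst.
apply: reg_congr (@reg_det _ (fun p => row' j (col' i (F p))) _); last first.
  by move=> h h'; apply: reg_congr (rF (lift j h) (lift i h')); apply: filterE => p; rewrite !mxE.
exact: filterE.
Qed.

(** If S0 is a constant left inverse of F q, then S0 F is a square matrix which
    is the identity at q, hence invertible near q, and (S0 F)^-1 S0 is a left
    inverse of F. *)
Lemma regmx_left_inverse N k (F : 'rV[K]_n -> 'M[K]_(N, k)) :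
  regmx A F q -> (forall v : 'cV_k, F q *m v = 0 -> v = 0) ->
  exists L : 'rV[K]_n -> 'M[K]_(k, N),
    regmx A L q /\ znbhs A q (fun p => L p *m F p = 1%:M).
Proof.
move=> rF inj.
have fullF : row_free (F q)^T.
  apply: inj_row_free => v vF; apply: trmx_inj; rewrite trmx0; apply: inj.
  by rewrite -[F q]trmxK -trmx_mul vF trmx0.
have [S0 S0F] : exists S0 : 'M_(k, N), S0 *m F q = 1%:M.
  have [B FB] := row_freeP fullF; exists B^T.
  by rewrite -[F q]trmxK -trmx_mul FB trmx1.
have rS : regmx A (fun p => S0 *m F p) q by apply: regmxM => //; exact: regmx_cst.
have uS : S0 *m F q \in unitmx by rewrite S0F unitmx1.
have [rI uI] := regmx_inv rS uS.
exists (fun p => invmx (S0 *m F p) *m S0); split.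
  by apply: regmxM => //; exact: regmx_cst.
by apply: filterS uI => p up; rewrite -mulmxA mulVmx.
Qed.

End AtPoint.

Lemma regmx_comp n m (A : set 'rV[K]_n) (B : set 'rV[K]_m) k l
    (H : 'rV[K]_n -> 'rV[K]_m) (F : 'rV[K]_m -> 'M[K]_(k, l)) q :
  A q -> (forall p, A p -> B (H p)) -> regmx A H q -> regmx B F (H q) ->
  regmx A (fun p => F (H p)) q.
Proof.
move=> Aq AB rH rF i j; have [a [b fr]] := rF i j.
have /fin_all_exists[w Hw] : forall j', exists c, dirder A (fun p => H p 0 j') q 0 c.
  by move=> j'; apply/(reg_dirder A _ q 0).
apply/(reg_dirder A _ q 0).
have Hw' j' : dirder A (fun p => H p 0 j') q 0 ((\row_h w h) 0 j') by rewrite mxE.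
by eexists; exact: (dirder_comp Aq Hw' AB fr).
Qed.

Lemma znbhs_comp n m (A : set 'rV[K]_n) (B : set 'rV[K]_m) (H : 'rV[K]_n -> 'rV[K]_m) q S :
  A q -> (forall p, A p -> B (H p)) -> regmx A H q -> znbhs B (H q) S ->
  znbhs A q (fun p => S (H p)).
Proof.
move=> Aq AB rH [b bq bS].
have rb : regmx B (fun x => (ev b x)%:M : 'M_1) (H q).
  move=> i j; rewrite !ord1.
  have [a [d [fr _]]] := dirder_poly B b (H q) 0.
  by exists a, d; case: fr => ? fr; split=> // p Bp dp; rewrite mxE eqxx mulr1n fr.
have [] := regmx_inv Aq (regmx_comp Aq AB rH rb).
  by rewrite unitmxE det_scalar unitfE expr1.
move=> _ u; apply: filterS2 u (znbhs_base A q) => p.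
rewrite unitmxE det_scalar unitfE expr1 => bp Ap; apply: bS => //; exact: AB.
Qed.

Lemma regular_mapE n m (A : set 'rV[K]_n) (F : 'rV[K]_n -> 'rV[K]_m) :
  regular_map A F <-> forall q, A q -> regmx A F q.
Proof.
split=> rF; first by move=> q Aq i j; rewrite ord1; have /regularE := rF j; exact.
by move=> j; apply/regularE => q Aq; exact: rF.
Qed.

Lemma regmx_qgrad n (A : set 'rV[K]_n) a b q : A q -> ev b q != 0 ->
  regmx A (qgrad a b) q.
Proof.
move=> Aq bq i j.
have rp p : reg_at A (ev p) q.
  by apply/(reg_dirder A _ q 0); eexists; exact: dirder_poly.
apply: (@reg_congr _ _ _ _ _ (fun p => (ev (b * b) p)^-1 *
  (ev (b * mderiv i a - a * mderiv i b) p))).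
  by apply: filterE => p; rewrite !mxE evB !evM.
by apply: regM => //; apply: regV; rewrite ?evM ?mulf_neq0.
Qed.

Lemma dmap_dirder n m (A : set 'rV[K]_n) (F : 'rV[K]_n -> 'rV[K]_m) q v (w : 'rV[K]_m) :
  A q -> tangent A q v -> (forall j, dirder A (fun p => F p 0 j) q v (w 0 j)) ->
  dmap A F q v = w.
Proof.
move=> Aq vq Fw; apply/rowP => j; rewrite -(rgradE Aq vq (Fw j)) /dmap !mxE.
by apply: eq_bigr => i _; rewrite mxE.
Qed.

Lemma dirder_dmap n m (A : set 'rV[K]_n) (F : 'rV[K]_n -> 'rV[K]_m) q v :
  A q -> tangent A q v -> regmx A F q ->
  forall j, dirder A (fun p => F p 0 j) q v (dmap A F q v 0 j).
Proof.
move=> Aq vq rF j; have [c fc] := (reg_dirder A _ q v).1 (rF 0 j).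
suff -> : dmap A F q v 0 j = c by [].
by rewrite -(rgradE Aq vq fc) /dmap !mxE; apply: eq_bigr => i _; rewrite mxE.
Qed.

(** For p in the ideal of B, the function p o F vanishes on A; compute its
    derivative along v by the chain rule. *)
Lemma tangent_dmap n m (A : set 'rV[K]_n) (B : set 'rV[K]_m)
    (F : 'rV[K]_n -> 'rV[K]_m) q v :
  A q -> tangent A q v -> (forall p, A p -> B (F p)) -> regmx A F q ->
  tangent B (F q) (dmap A F q v).
Proof.
move=> Aq vq AB rF p pB; apply/rowP => j; rewrite !ord1 [RHS]mxE.
apply: dirder_uniq (dirder_ev_comp Aq (dirder_dmap Aq vq rF) p) _ => //.
apply: dirder_congr (dirder_cst A 0 q v).
by apply: filterS (znbhs_base A q) => x Ax; exact/pB/AB.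
Qed.

(** The matrix [jac] is built from an arbitrary local fraction at each point, so
    its entries need not be regular.  Keeping the fractions of the point q gives
    a regular matrix D with the same effect on tangent vectors. *)
Lemma regmx_jac n m (A : set 'rV[K]_n) (F : 'rV[K]_n -> 'rV[K]_m) q :
  A q -> regmx A F q -> exists D : 'rV[K]_n -> 'M[K]_(n, m),
    regmx A D q /\ znbhs A q (fun p =>
      (forall v, tangent A p v -> dmap A F p v = v *m D p) /\
      forall j, has_differential A (fun x => F x 0 j) p (col j (D p))).
Proof.
move=> Aq rF.
have /fin_all_exists2 : forall j, exists2 a, True & exists b, frac_at A (fun p => F p 0 j) q a b.
  by move=> j; have [a ab] := rF 0 j; exists a.
move=> [a _] /fin_all_exists[b fr].
pose D p := \matrix_(i, j) qgrad (a j) (b j) p i 0 : 'M[K]_(n, m).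
exists D; split.
  move=> i j; apply: reg_congr (@regmx_qgrad _ A (a j) (b j) q Aq _ i 0).
    by apply: filterE => p; rewrite mxE.
  by case: (fr j).
have frn : znbhs A q (fun p => forall j, frac_at A (fun x => F x 0 j) p (a j) (b j)).
  exact: (znbhs_forall (fun j => frac_near (fr j))).
apply: filterS2 frn (znbhs_base A q) => p frp Ap.
have colD j : col j (D p) = qgrad (a j) (b j) p by apply/colP => i; rewrite !mxE.
split=> [v vp|j]; last by rewrite colD; exact: frac_has_differential.
apply: dmap_dirder => // j; exists (a j), (b j); split; first exact: frp.
by rewrite -colD !mxE; apply: eq_bigr => i _; rewrite mxE.
Qed.

(** The partial derivative of F with respect to its second variable, at a moving
    point (x p, y p), depends regularly on p.  It is the lower block of the
    gradients of the fractions that represent F near (x q, y q), as w |-> (x p, w)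
    has derivative (0, v) along v. *)
Lemma regmx_partial_r n k m l (A : set 'rV[K]_n) (B : set 'rV[K]_k) (C : set 'rV[K]_m)
    (F : 'rV[K]_k -> 'rV[K]_m -> 'rV[K]_l) (x : 'rV[K]_n -> 'rV[K]_k)
    (y : 'rV[K]_n -> 'rV[K]_m) q :
  regular_map (setprod B C) (fun z => F (lsubmx z) (rsubmx z)) ->
  (forall p, A p -> B (x p)) -> (forall p, A p -> C (y p)) ->
  A q -> regmx A x q -> regmx A y q ->
  exists D : 'rV[K]_n -> 'M[K]_(m, l), regmx A D q /\
    znbhs A q (fun p => forall v, tangent C (y p) v ->
      dmap C (F (x p)) (y p) v = v *m D p).
Proof.
move=> rF AB AC Aq rx ry.
pose z p := row_mx (x p) (y p).
have Az p : A p -> setprod B C (z p).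
  by move=> Ap; split; rewrite ?row_mxKl ?row_mxKr; [exact: AB | exact: AC].
have rz : regmx A z q by exact: regmx_row.
have rFz := (regular_mapE _ _).1 rF _ (Az q Aq).
have /fin_all_exists2 : forall j, exists2 a, True & exists b,
    frac_at (setprod B C) (fun w => F (lsubmx w) (rsubmx w) 0 j) (z q) a b.
  by move=> j; have [a ab] := rFz 0 j; exists a.
move=> [a _] /fin_all_exists[b fr].
pose D p := dsubmx (\matrix_(i, j) qgrad (a j) (b j) (z p) i 0 : 'M[K]_(k + m, l)).
exists D; split.
  move=> i j.
  have rg := @regmx_qgrad _ (setprod B C) (a j) (b j) (z q) (Az q Aq) (fr j).1.
  apply: reg_congr (regmx_comp Aq Az rz rg (rshift k i) 0).
  by apply: filterE => p; rewrite !mxE.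
have frn : znbhs (setprod B C) (z q) (fun w => forall j,
    frac_at (setprod B C) (fun w' => F (lsubmx w') (rsubmx w') 0 j) w (a j) (b j)).
  exact: (znbhs_forall (fun j => frac_near (fr j))).
have {}frn := znbhs_comp Aq Az rz frn.
apply: filterS2 frn (znbhs_base A q) => p frp Ap v vp.
apply: (@dmap_dirder _ _ C) => //; first exact: AC.
move=> j.
pose h w := row_mx (x p) w : 'rV[K]_(k + m).
have hd i : dirder C (fun w => h w 0 i) (y p) v ((row_mx 0 v : 'rV[K]_(k + m)) 0 i).
  rewrite -(splitK i); case: (fintype.split i) => i' /=.
    rewrite row_mxEl mxE; apply: dirder_congr (dirder_cst _ (x p 0 i') _ _).
    by apply: filterE => w; rewrite /h row_mxEl.
  rewrite row_mxEr; apply: dirder_congr (dirder_coord _ i' _ _).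
  by apply: filterE => w; rewrite /h row_mxEr.
have Ch w : C w -> setprod B C (h w).
  by move=> Cw; split; rewrite ?row_mxKl ?row_mxKr //; exact: AB.
have := dirder_comp (AC p Ap) hd Ch (frp j).
have -> : (row_mx 0 v *m qgrad (a j) (b j) (h (y p))) 0 0 = (v *m D p) 0 j.
  rewrite -[qgrad _ _ _]vsubmxK mul_row_col mul0mx add0r !mxE.
  by apply: eq_bigr => i _; rewrite !mxE.
by apply: dirder_congr; apply: filterE => w; rewrite row_mxKl row_mxKr.
Qed.

Lemma regmx_partial_l n k m l (A : set 'rV[K]_n) (B : set 'rV[K]_k) (C : set 'rV[K]_m)
    (F : 'rV[K]_k -> 'rV[K]_m -> 'rV[K]_l) (x : 'rV[K]_n -> 'rV[K]_k)
    (y : 'rV[K]_n -> 'rV[K]_m) q :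
  regular_map (setprod B C) (fun z => F (lsubmx z) (rsubmx z)) ->
  (forall p, A p -> B (x p)) -> (forall p, A p -> C (y p)) ->
  A q -> regmx A x q -> regmx A y q ->
  exists D : 'rV[K]_n -> 'M[K]_(k, l), regmx A D q /\
    znbhs A q (fun p => forall v, tangent B (x p) v ->
      dmap B (fun w => F w (y p)) (x p) v = v *m D p).
Proof.
move=> rF AB AC Aq rx ry.
apply: (@regmx_partial_r _ _ _ _ A C B (fun w w' => F w' w)) => //.
apply/regular_mapE => z [Cz Bz].
have sw p : setprod C B p -> setprod B C (row_mx (rsubmx p) (lsubmx p)).
  by case=> Cp Bp; split; rewrite ?row_mxKl ?row_mxKr.
have {}rFz := (regular_mapE _ _).1 rF _ (sw z (conj Cz Bz)).
have zz : setprod C B z by [].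
have rsw : regmx (setprod C B) (fun p => row_mx (rsubmx p) (lsubmx p)) z.
  by apply: regmx_row => //; [apply: regmx_rsub | apply: regmx_lsub] => //; exact: regmx_id.
apply: regmx_congr (regmx_comp zz sw rsw rFz).
by apply: filterE => p; rewrite row_mxKl row_mxKr.
Qed.

End RegularMatrices.

(** * Tangent spaces, 2-forms and bivectors *)

Section Tangent.
Variable K : numFieldType.

Lemma eq_mulmxr k l (X Y : 'M[K]_(k, l)) : (forall w : 'rV_k, w *m X = w *m Y) -> X = Y.
Proof. by move=> XY; apply/row_matrixP => i; rewrite !rowE XY. Qed.

Lemma tangent_lin n (A : set 'rV[K]_n) q c u v :
  tangent A q u -> tangent A q v -> tangent A q (c *: u + v).
Proof.
by move=> uq vq p pA; rewrite mulmxDl -scalemxAl uq // vq // scaler0 addr0.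
Qed.

Lemma tangent0 n (A : set 'rV[K]_n) q : tangent A q 0.
Proof. by move=> p pA; rewrite mul0mx. Qed.

Lemma tangentD n (A : set 'rV[K]_n) q u v :
  tangent A q u -> tangent A q v -> tangent A q (u + v).
Proof. by rewrite -{2}[u]scale1r; exact: tangent_lin. Qed.

Lemma tangentZ n (A : set 'rV[K]_n) q c u : tangent A q u -> tangent A q (c *: u).
Proof.
by move=> uq; rewrite -[_ *: _]addr0; apply: tangent_lin => //; exact: tangent0.
Qed.

Lemma tangentN n (A : set 'rV[K]_n) q u : tangent A q u -> tangent A q (- u).
Proof. by move=> uq; rewrite -scaleN1r; exact: tangentZ. Qed.

(** Near q the tangent spaces are the kernels of the Jacobian matrix J of the
    local generators f_i of the ideal: for g in the ideal, differentiate
    h^N g = sum c_i f_i at a point of A.  As J has full rank at q, its transpose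
    has a regular left inverse L, and 1 - J^T L projects onto the kernel. *)
Lemma tangent_projector n (A : set 'rV[K]_n) q : nonsingular A -> A q ->
  exists pi : 'rV[K]_n -> 'M[K]_n, regmx A pi q /\
    znbhs A q (fun p => (forall w, tangent A p (w *m pi p)) /\
      forall v, tangent A p v -> v *m pi p = v).
Proof.
move=> nsA Aq; have [r [f [h [/eqP hq fA ff gen]]]] := nsA q Aq.
pose J p : 'M[K]_(r, n) := \matrix_(i < r) (pgrad (f i) p)^T.
have JE p (v : 'rV_n) : v *m (J p)^T = 0 <-> forall i, v *m pgrad (f i) p = 0.
  have JEi i : (v *m (J p)^T) 0 i = (v *m pgrad (f i) p) 0 0.
    by rewrite !mxE; apply: eq_bigr => j _; rewrite !mxE.
  split=> [vJ i|vf]; last by apply/rowP => i; rewrite JEi vf !mxE.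
  by apply/rowP => j; rewrite ord1 -JEi vJ !mxE.
have rJ : regmx A (fun p => (J p)^T) q.
  move=> i j; apply: (@reg_congr _ _ _ _ _ (ev (mderiv i (f j)))).
    by apply: filterE => p; rewrite !mxE.
  by apply/(reg_dirder A _ q 0); eexists; exact: dirder_poly.
have Jinj (v : 'cV_r) : (J q)^T *m v = 0 -> v = 0.
  move=> Jv; apply: trmx_inj; apply: (row_free_inj ff).
  by rewrite trmx0 mul0mx -[RHS]trmx0 -Jv trmx_mul trmxK.
have [L [rL LJ]] := regmx_left_inverse Aq rJ Jinj.
exists (fun p => 1%:M - (J p)^T *m L p); split.
  by apply: regmxB => //; [exact: regmx_cst | exact: regmxM].
have hn : znbhs A q (fun p => ev h p != 0) by exists h.
apply: filterS3 LJ hn (znbhs_base A q) => p LJp hp Ap; split=> [w|v vp].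
  have /JE wJ : w *m (1%:M - (J p)^T *m L p) *m (J p)^T = 0.
    by rewrite -mulmxA mulmxBl mul1mx -mulmxA LJp mulmx1 subrr mulmx0.
  move=> g gA; set u := w *m _ in wJ *.
  have [N [c hg]] := gen g gA.
  have hN : ev (h ^+ N) p != 0.
    by elim: N {hg} => [|N IHN]; rewrite ?expr0 ?ev1 ?oner_neq0 // exprS evM mulf_neq0.
  have : pder u (h ^+ N * g) p = 0.
    rewrite hg; elim/big_ind: _ => [|a b ea eb|i _].
    - by rewrite /pder -[X in pgrad X]mpolyC0 pgradC mulmx0 mxE.
    - by rewrite pderD ea eb addr0.
    - by rewrite pderM fA // mul0r add0r /pder wJ mxE mulr0.
  rewrite pderM gA // mul0r add0r => /eqP; rewrite mulf_eq0 (negPf hN) /= => /eqP e.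
  by apply/rowP => i; rewrite (ord1 i) [RHS]mxE.
have vJ : v *m (J p)^T = 0 by apply/JE => i; exact: vp.
by rewrite mulmxBr mulmx1 mulmxA vJ mul0mx subr0.
Qed.

Lemma reg_setI_open n (A U : set 'rV[K]_n) f q : zariski_open U -> U q ->
  reg_at (A `&` U) f q -> reg_at A f q.
Proof.
move=> Uo Uq [a [b [bq fab]]]; have [h hq hU] := zariski_open_nbhs A Uo Uq.
exists (a * h), (b * h); split=> [|p Ap]; rewrite !evM; first exact: mulf_neq0.
rewrite mulf_eq0 => /norP[bp hp].
by rewrite fab //; [field; rewrite bp hp | split=> //; exact: hU].
Qed.

Lemma regmx_near n (A : set 'rV[K]_n) k l (F : 'rV[K]_n -> 'M[K]_(k, l)) q :
  regmx A F q -> znbhs A q (regmx A F).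
Proof.
move=> rF; apply: znbhs_forall => i; apply: znbhs_forall => j.
have [a [b fr]] := rF i j.
by apply: filterS (frac_near fr) => p frp; exists a, b.
Qed.

Lemma form_atZ n c (A : 'M[K]_n) u v : form_at (c *: A) u v = c * form_at A u v.
Proof. by rewrite /form_at -scalemxAr -scalemxAl mxE. Qed.

Lemma form_at_tr n (A : 'M[K]_n) u v : form_at A^T u v = form_at A v u.
Proof.
have -> : form_at A^T u v = (v *m A *m u^T)^T 0 0.
  by rewrite !trmx_mul trmxK mulmxA.
by rewrite mxE.
Qed.

Lemma form_atB n (A B : 'M[K]_n) u v : form_at (A - B) u v = form_at A u v - form_at B u v.
Proof. by rewrite /form_at mulmxBr mulmxBl mxE [X in _ + X]mxE. Qed.

Lemma form_at_sum n (A : 'M[K]_n) u v : form_at A u v = \sum_i \sum_j A i j * (u 0 i * v 0 j).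
Proof.
rewrite /form_at -mulmxA mxE; apply: eq_bigr => i _; rewrite mxE mulr_sumr.
by apply: eq_bigr => j _; rewrite mxE; ring.
Qed.

Lemma sum_dxdx n (c : 'I_n -> 'I_n -> K) u v :
  \sum_i \sum_j c i j * dxdx i j u v =
  form_at (\matrix_(i, j) c i j) u v - form_at (\matrix_(i, j) c i j) v u.
Proof.
rewrite !form_at_sum -sumrB; apply: eq_bigr => i _; rewrite -sumrB.
by apply: eq_bigr => j _; rewrite !mxE /dxdx; ring.
Qed.

Lemma smooth_2form_skew n (A : set 'rV[K]_n) s q u v : smooth_2form A s -> A q ->
  tangent A q u -> tangent A q v -> form_at (s q) u v = - form_at (s q) v u.
Proof.
move=> ss Aq uq vq; have [U [c [_ Uq _ sc]]] := ss q Aq.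
by rewrite !(sc q) // !sum_dxdx opprB.
Qed.

(** The matrix c - c^T represents sum c_ij dx_i /\ dx_j. *)
Lemma algebraic_2formP n (A : set 'rV[K]_n) s q : algebraic_2form A s -> A q ->
  exists C : 'rV[K]_n -> 'M[K]_n, regmx A C q /\
    znbhs A q (fun p => forall u v, tangent A p u -> tangent A p v ->
      form_at (s p) u v = form_at (C p) u v).
Proof.
move=> As Aq; have [U [c [Uo Uq rc sc]]] := As q Aq.
exists (fun p => \matrix_(i, j) c i j p - (\matrix_(i, j) c i j p)^T); split.
  have r : regmx A (fun p => \matrix_(i, j) c i j p) q.
    move=> i j; apply: (@reg_congr _ _ _ _ _ (c i j)).
      by apply: filterE => p; rewrite mxE.
    apply: (reg_setI_open Uo Uq).
    by apply: (regularE _ _).1 => //; exact: rc.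
  by apply: regmxB => //; exact: regmxT.
apply: filterS2 (zariski_open_nbhs A Uo Uq) (znbhs_base A q) => p Up Ap u v up vp.
by rewrite sc // sum_dxdx form_atB form_at_tr.
Qed.

(** On tangent vectors s is skew, so half of any matrix that represents s
    provides coefficients for the dx_i /\ dx_j. *)
Lemma algebraic_2form_of n (A : set 'rV[K]_n) s : smooth_2form A s ->
  (forall q, A q -> exists C : 'rV[K]_n -> 'M[K]_n, regmx A C q /\
    znbhs A q (fun p => forall u v, tangent A p u -> tangent A p v ->
      form_at (s p) u v = form_at (C p) u v)) ->
  algebraic_2form A s.
Proof.
move=> ss h q Aq; have [C [rC sC]] := h q Aq.
have [b bq bS] := znbhsI (regmx_near (regmxZ Aq 2^-1 rC)) sC.
exists [set p | ev b p <> 0], (fun i j p => (2^-1 *: C p) i j); split.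
- exact: principal_open.
- exact/eqP.
- move=> i j; apply/regularE => p [Ap /eqP bp].
  have [/(_ i j)[a [d [dp fr]]] _] := bS p Ap bp.
  by exists a, d; split=> // p' [Ap' _]; exact: fr.
- move=> p u v Ap /eqP bp up vp; have [_ sp] := bS p Ap bp.
  rewrite sum_dxdx.
  have -> : \matrix_(i, j) (2^-1 *: C p) i j = 2^-1 *: C p by apply/matrixP => i j; rewrite mxE.
  rewrite !form_atZ -!sp // (smooth_2form_skew ss Ap vp up).
  by field.
Qed.

(** The rows of P are tangent, so P c = 0, and P is skew. *)
Lemma sharp_eq0 n (A : set 'rV[K]_n) P q (c : 'cV[K]_n) : bivector A P -> A q ->
  (forall v, tangent A q v -> v *m c = 0) -> sharp P q c = 0.
Proof.
move=> bP Aq cT; have [skew tP] := bP q Aq.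
apply: trmx_inj; rewrite /sharp trmx_mul trmxK skew trmx0 mulNmx.
apply/eqP; rewrite oppr_eq0; apply/eqP.
by apply/row_matrixP => i; rewrite row_mul row0 cT.
Qed.

End Tangent.

(** * Regularity of the data of a group-valued momentum map *)

Section GroupData.
Variables (K : numFieldType) (G : affine_group K).
Local Notation vecG := 'rV[K]_(gdim G).

Lemma gmulgV (h : vecG) : gset G h -> gmul h (ginv h) = gone G.
Proof.
move=> Gh; have Gi := gset_inv Gh; have Gk := gset_mul Gh Gi.
have kk : gmul (gmul h (ginv h)) (gmul h (ginv h)) = gmul h (ginv h).
  by rewrite -gmulA // [X in gmul h X]gmulA // gmulV // gmul1.
have Gki := gset_inv Gk.
by rewrite -[LHS]gmul1 // -{1}(gmulV Gk) -gmulA // kk gmulV.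
Qed.

Lemma regmx_gmul n (A : set 'rV[K]_n) (x y : 'rV[K]_n -> vecG) q : A q ->
  (forall p, A p -> gset G (x p)) -> (forall p, A p -> gset G (y p)) ->
  regmx A x q -> regmx A y q -> regmx A (fun p => gmul (x p) (y p)) q.
Proof.
move=> Aq Gx Gy rx ry.
have Az p : A p -> setprod (gset G) (gset G) (row_mx (x p) (y p)).
  by move=> Ap; split; rewrite ?row_mxKl ?row_mxKr; [exact: Gx | exact: Gy].
have rm := (regular_mapE _ _).1 (@gmul_regular _ G) _ (Az q Aq).
apply: regmx_congr (regmx_comp Aq Az (regmx_row rx ry) rm).
by apply: filterE => p; rewrite row_mxKl row_mxKr.
Qed.

Lemma lie0 : @lie K G 0.
Proof. exact: tangent0. Qed.

Lemma mcL_lie h v : gset G h -> tangent (gset G) h v -> lie (mcL h v).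
Proof.
move=> Gh hv; rewrite /lie -(gmulV Gh).
apply: (tangent_dmap (F := fun x => gmul (ginv h) x)) => //.
  by move=> x Gx; apply: gset_mul => //; exact: gset_inv.
apply: regmx_gmul => //; last exact: regmx_id.
  by move=> *; exact: gset_inv.
exact: regmx_cst.
Qed.

Lemma mcR_lie h v : gset G h -> tangent (gset G) h v -> lie (mcR h v).
Proof.
move=> Gh hv; rewrite /lie -(gmulgV Gh).
apply: (tangent_dmap (F := fun x => gmul x (ginv h))) => //.
  by move=> x Gx; apply: gset_mul => //; exact: gset_inv.
apply: regmx_gmul => //; first by move=> *; exact: gset_inv.
  exact: regmx_id.
exact: regmx_cst.
Qed.

Section Basis.
Variables (r : nat) (e : 'I_r -> vecG).
Hypothesis he : lie_basis e.

Lemma lie_coord X : lie X -> exists a : 'rV_r, X = a *m \matrix_j e j.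
Proof.
move=> /he.2 [a [-> _]]; exists a; rewrite mulmx_sum_row.
by apply: eq_bigr => j _; rewrite rowK.
Qed.

Lemma lie_basis_inverse : exists B : 'M[K]_(gdim G, r), (\matrix_j e j) *m B = 1%:M.
Proof.
apply/row_freeP/inj_row_free => a; rewrite mulmx_sum_row => a0.
have [b [_ bu]] := he.2 0 lie0.
have ea : 0 = \sum_j a 0 j *: e j.
  by rewrite -[LHS]a0; apply: eq_bigr => j _; rewrite rowK.
rewrite -(bu a ea); apply: bu.
by rewrite /= big1 // => j _; rewrite mxE scale0r.
Qed.

(** The functionals are only linear on the Lie algebra, on which the right
    inverse of the matrix of the basis computes coordinates. *)
Lemma linear_on_matrix (xi : 'I_r -> vecG -> K) :
  (forall k, linear_on (@lie K G) (xi k)) ->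
  exists B : 'M[K]_(gdim G, r), forall Y, lie Y -> forall k, xi k Y = (Y *m B) 0 k.
Proof.
move=> lxi; have [E' EE'] := lie_basis_inverse.
exists (E' *m \matrix_(j, k) xi k (e j)) => Y lY k.
have [a ->] := lie_coord lY; rewrite -mulmxA [_ *m (E' *m _)]mulmxA EE' mul1mx.
have x0 : xi k 0 = 0.
  have := lxi k 1 0 0 lie0 lie0.
  by rewrite scaler0 addr0 mul1r -[LHS]addr0 => /addrI.
rewrite mulmx_sum_row [RHS]mxE.
have [] : lie (\sum_j a 0 j *: row j (\matrix_j e j)) /\
    xi k (\sum_j a 0 j *: row j (\matrix_j e j)) = \sum_j a 0 j * xi k (e j).
  elim/big_ind2: _ => [|c X d Z [lX xX] [lZ xZ]|j _].
  - by split=> //; exact: tangent0.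
  - split; first exact: tangentD.
    by have := lxi k 1 X Z lX lZ; rewrite scale1r mul1r xX xZ.
  - rewrite rowK; have lej := he.1 j; split; first exact: tangentZ.
    by have := lxi k (a 0 j) _ _ lej lie0; rewrite x0 !addr0.
by move=> _ ->; apply: eq_bigr => j _; rewrite mxE.
Qed.

End Basis.

Variables (V : affine_gvariety G) (Phi : 'rV[K]_(vdim V) -> vecG).
Hypothesis hPhi : equivariant_morphism Phi.
Local Notation M := (vset V).
Local Notation vecM := 'rV[K]_(vdim V).

Lemma PhiG q : M q -> gset G (Phi q).
Proof. by case: hPhi => + _ _; exact. Qed.

Lemma regmx_Phi q : M q -> regmx M Phi q.
Proof. by case: hPhi => _ /regular_mapE + _; exact. Qed.

Lemma regmx_invPhi q : M q -> regmx M (fun p => ginv (Phi p)) q.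
Proof.
move=> Mq; have rg := (regular_mapE _ _).1 (@ginv_regular _ G) _ (PhiG Mq).
exact: regmx_comp Mq PhiG (regmx_Phi Mq) rg.
Qed.

Lemma dPhi_tangent q u : M q -> tangent M q u ->
  tangent (gset G) (Phi q) (dmap M Phi q u).
Proof. by move=> Mq uq; apply: tangent_dmap => //; [exact: PhiG | exact: regmx_Phi]. Qed.

Lemma regmx_mc q : M q -> exists L R : vecM -> 'M[K]_(vdim V, gdim G),
  [/\ regmx M L q, regmx M R q & znbhs M q (fun p => forall u, tangent M p u ->
    mcL (Phi p) (dmap M Phi p u) = u *m L p /\
    mcR (Phi p) (dmap M Phi p u) = u *m R p)].
Proof.
move=> Mq; have [D [rD dD]] := regmx_jac Mq (regmx_Phi Mq).
have GiPhi p : M p -> gset G (ginv (Phi p)) by move=> /PhiG; exact: gset_inv.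
have [L [rL dL]] := regmx_partial_r (@gmul_regular _ G) GiPhi PhiG Mq
  (regmx_invPhi Mq) (regmx_Phi Mq).
have [R [rR dR]] := regmx_partial_l (@gmul_regular _ G) PhiG GiPhi Mq
  (regmx_Phi Mq) (regmx_invPhi Mq).
exists (fun p => D p *m L p), (fun p => D p *m R p); split; try exact: regmxM.
have dLR := znbhsI dL dR.
apply: filterS3 dD dLR (znbhs_base M q) => p [Dp _] [Lp Rp] Mp u up.
have t := dPhi_tangent Mp up.
by rewrite /mcL /mcR Lp // Rp // Dp // !mulmxA.
Qed.

Lemma regmx_fund q : M q -> exists F : vecM -> 'M[K]_(gdim G, vdim V),
  regmx M F q /\ znbhs M q (fun p => forall X, lie X -> fund (V := V) X p = X *m F p).
Proof.
move=> Mq.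
have [F [rF dF]] := regmx_partial_l (@act_regular _ _ V) (fun p _ => @gset_one _ G)
  (fun p Mp => Mp) Mq (regmx_cst _ _ (gone G)) (regmx_id M q).
exists (fun p => -1 *: F p); split; first exact: regmxZ.
apply: filterS dF => p Fp X lX; rewrite /fund Fp; last exact: tangentN.
by rewrite mulNmx scaleN1r mulmxN.
Qed.

Lemma fund_tangent q X : M q -> lie X -> tangent M q (fund (V := V) X q).
Proof.
move=> Mq lX; rewrite -{1}(act1 Mq).
apply: (tangent_dmap (F := fun g => @act _ _ V g q)) => //.
- exact: gset_one.
- exact: tangentN.
- by move=> g Gg; exact: vset_act.
have Gz g : gset G g -> setprod (gset G) M (row_mx g q).
  by move=> Gg; split; rewrite ?row_mxKl ?row_mxKr.
have rz : regmx (gset G) (fun g => row_mx g q) (gone G).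
  by apply: regmx_row; [exact: regmx_id | exact: regmx_cst].
have ra := (regular_mapE _ _).1 (@act_regular _ _ V) _ (Gz _ (@gset_one _ G)).
apply: regmx_congr (regmx_comp (@gset_one _ G) Gz rz ra).
by apply: filterE => g; rewrite row_mxKl row_mxKr.
Qed.

Lemma rho_fund q u : M q -> tangent M q u ->
  exists2 X, lie X & rho Phi q u = fund (V := V) X q.
Proof.
move=> Mq uq; have t := dPhi_tangent Mq uq; eexists; last by [].
by apply: tangentD; [|apply: tangentN]; [apply: mcL_lie | apply: mcR_lie] => //; exact: PhiG.
Qed.

Lemma regmx_rho q : M q -> exists R : vecM -> 'M[K]_(vdim V),
  regmx M R q /\ znbhs M q (fun p => forall u, tangent M p u -> rho Phi p u = u *m R p).
Proof.
move=> Mq; have [L [R [rL rR dLR]]] := regmx_mc Mq; have [F [rF dF]] := regmx_fund Mq.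
exists (fun p => (L p - R p) *m F p); split; first by apply: regmxM => //; exact: regmxB.
apply: filterS3 dLR dF (znbhs_base M q) => p LRp Fp Mp u up.
have t := dPhi_tangent Mp up.
rewrite /rho Fp; last first.
  by apply: tangentD; [|apply: tangentN]; [apply: mcL_lie | apply: mcR_lie] => //; exact: PhiG.
by have [-> ->] := LRp u up; rewrite mulmxA mulmxBr.
Qed.

(** The matrix T p gives the vector fields X^L + X^R of G at Phi p, which occur
    in the momentum property of a bivector. *)
Lemma regmx_trans q : M q -> exists T : vecM -> 'M[K]_(gdim G),
  regmx M T q /\ znbhs M q (fun p => forall X, lie X ->
    ltrans (Phi p) X + rtrans (Phi p) X = X *m T p).
Proof.
move=> Mq.
have [L [rL dL]] := regmx_partial_r (@gmul_regular _ G) PhiG (fun p _ => @gset_one _ G)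
  Mq (regmx_Phi Mq) (regmx_cst _ _ (gone G)).
have [R [rR dR]] := regmx_partial_l (@gmul_regular _ G) (fun p _ => @gset_one _ G) PhiG
  Mq (regmx_cst _ _ (gone G)) (regmx_Phi Mq).
exists (fun p => L p + R p); split; first exact: regmxD.
by apply: filterS2 dL dR => p Lp Rp X lX; rewrite /ltrans /rtrans Lp // Rp // mulmxDr.
Qed.

End GroupData.

(** * Momentum duality *)

Section Duality.
Variables (K : numFieldType) (G : affine_group K) (V : affine_gvariety G).
Variable Phi : 'rV[K]_(vdim V) -> 'rV[K]_(gdim G).
Hypothesis hPhi : equivariant_morphism Phi.
Variable bil : 'rV[K]_(gdim G) -> 'rV[K]_(gdim G) -> K.
Hypothesis hbil : forall X, lie X -> linear_on (@lie K G) (bil X).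
Variables (r : nat) (e : 'I_r -> 'rV[K]_(gdim G)) (eta : 'M[K]_r).
Hypothesis he : lie_basis e.
Variables sigma P : 'rV[K]_(vdim V) -> 'M[K]_(vdim V).
Local Notation M := (vset V).
Hypothesis bP : bivector M P.
Hypothesis ss : smooth_2form M sigma.
Hypothesis dual : momentum_dual Phi bil e eta sigma P.

Let E : 'M[K]_(r, gdim G) := \matrix_j e j.

Lemma dual_nondegenerate : Phi_nondegenerate Phi sigma.
Proof.
move=> q u Mq uq su du; have [_ _ /(_ q u Mq uq)] := dual.
rewrite (sharp_eq0 bP Mq) => [|v vq]; last first.
  apply/rowP => i; rewrite (ord1 i) [RHS]mxE -[RHS](su v vq) /form_at /flat.
  have -> : v *m (u *m sigma q)^T = (u *m sigma q *m v^T)^T by rewrite [RHS]trmx_mul trmxK.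
  by rewrite mxE.
have -> : rho Phi q u = 0.
  by rewrite /rho du /mcL /mcR /dmap !mul0mx subrr /fund /dmap oppr0 mul0mx.
by rewrite scaler0 subr0.
Qed.

Lemma duality_matrix q (R : 'M[K]_(vdim V)) : M q ->
  (forall u, tangent M q u -> rho Phi q u = u *m R) ->
  forall u, tangent M q u -> u *m sigma q *m P q = u *m (1%:M - 4^-1 *: R).
Proof.
move=> Mq Rq u uq; have [_ _ /(_ q u Mq uq)] := dual.
by rewrite /sharp /flat trmxK => ->; rewrite Rq // mulmxBr mulmx1 -scalemxAr.
Qed.

(** The momentum property of P for the coordinate functions of G, all at once:
    column j of D is the covector Phi^* dx_j. *)
Lemma poisson_momentum_matrix q D F T : M q ->
  (forall j, has_differential M (fun x => Phi x 0 j) q (col j D)) ->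
  (forall X, lie X -> fund (V := V) X q = X *m F) ->
  (forall X, lie X -> ltrans (Phi q) X + rtrans (Phi q) X = X *m T) ->
  D^T *m P q = 2^-1 *: ((E *m T)^T *m eta *m (E *m F)).
Proof.
move=> Mq dD dF dT; have [_ mP _] := dual.
have two : (2 : K) != 0 by rewrite pnatr_eq0.
apply: (scalerI two); rewrite scalerA mulfV // scale1r.
apply/row_matrixP => i.
have sm : smooth_fun (gset G) (fun h => h 0 i).
  by move=> h Gh; eexists; exact: coord_has_differential.
have := mP _ sm q _ _ Mq (dD i) (coord_has_differential (gset G) i (Phi q)).
rewrite /sharp tr_col -row_mul.
have -> : row i (2 *: (D^T *m P q)) = 2 *: row i (D^T *m P q).
  by apply/rowP => k; rewrite !mxE.
move=> ->; rewrite row_mul mulmx_sum_row exchange_big; apply: eq_bigr => k _ /=.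
have Erow l (X : 'M_(gdim G, l)) k' : row k' (E *m X) = e k' *m X by rewrite row_mul rowK.
rewrite -scaler_suml Erow dF; last exact: he.1.
congr (_ *: _); rewrite !mxE; apply: eq_bigr => j _.
rewrite dT; last exact: he.1.
by rewrite -colE mxE mulrC -(Erow _ T j) !mxE.
Qed.

(** The system A P = B has three blocks of rows: the covectors sigma^b(u) for u
    in the image of pi, the covectors Phi^* dx_j, and the annihilator of the
    tangent space. *)
Lemma form_algebraic_bivector : algebraic_2form M sigma -> algebraic_bivector M P.
Proof.
move=> As; split=> //; suff rP q : M q -> regmx M P q.
  by move=> i j; apply/regularE => q /rP; exact.
move=> Mq.
have [pi [rpi dpi]] := tangent_projector (@vset_nonsingular _ _ V) Mq.
have [C [rC dC]] := algebraic_2formP As Mq.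
have [D [rD dD]] := regmx_jac Mq (regmx_Phi hPhi Mq).
have [F [rF dF]] := regmx_fund Mq.
have [T [rT dT]] := regmx_trans hPhi Mq.
have [R [rR dR]] := regmx_rho hPhi Mq.
pose A p := col_mx (pi p *m C p) (col_mx (D p)^T (1%:M - pi p)^T).
pose B p := col_mx (pi p *m (1%:M - 4^-1 *: R p))
  (col_mx (2^-1 *: ((E *m T p)^T *m eta *m (E *m F p))) (0 : 'M_(vdim V))).
have r1 k l (X : 'M[K]_(k, l)) : regmx M (fun=> X) q by exact: regmx_cst.
have rA : regmx M A q.
  apply: regmx_col; first exact: regmxM.
  by apply: regmx_col; apply: regmxT => //; exact: regmxB.
have rB : regmx M B q.
  apply: regmx_col; first by do ?[apply: regmxM | apply: regmxB | apply: regmxZ].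
  apply: regmx_col; last exact: r1.
  by apply: regmxZ => //; do ![apply: regmxM => //]; apply: regmxT; exact: regmxM.
have AP : znbhs M q (fun p => A p *m P p = B p).
  have d1 := znbhsI dpi dC; have d2 := znbhsI dD dF; have d3 := znbhsI dT dR.
  have d := znbhsI d2 d3.
  apply: filterS3 d1 d (znbhs_base M q) => p [[pT pid] Cp] [[[_ Dp] Fp] [Tp Rp]] Mp.
  rewrite /A /B !mul_col_mx; congr col_mx; last congr col_mx.
  - apply: eq_mulmxr => w; rewrite !mulmxA -(duality_matrix Mp Rp) //.
    (* C represents sigma on tangent vectors only: the two covectors differ by
       an annihilator of the tangent space, which P kills *)
    apply/eqP; rewrite -subr_eq0 -mulmxBl; apply/eqP.
    rewrite -[X in X *m _]trmxK; apply: (sharp_eq0 bP Mp) => v vp.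
    apply: trmx_inj; rewrite trmx_mul trmxK trmx0 mulmxBl; apply/eqP; rewrite subr_eq0.
    by apply/eqP/rowP => i; rewrite (ord1 i); exact/esym/Cp.
  - exact: poisson_momentum_matrix.
  - have [skew tP] := bP Mp.
    apply: trmx_inj; rewrite trmx_mul trmxK skew mulNmx trmx0.
    apply/eqP; rewrite oppr_eq0; apply/eqP/row_matrixP => i.
    by rewrite row_mul mulmxBr mulmx1 pid // subrr row0.
have Ainj (v : 'cV_(vdim V)) : A q *m v = 0 -> v = 0.
  have [pT pid] := znbhs_point Mq dpi; have Cq := znbhs_point Mq dC.
  have [Dq _] := znbhs_point Mq dD.
  rewrite /A !mul_col_mx -[X in _ = X](@col_mx0 _ _ _ _); move=> /eq_col_mx[Cv].
  rewrite -[X in _ = X](@col_mx0 _ _ _ _) => /eq_col_mx[Dv piv].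
  have uq : tangent M q v^T.
    have <- : v^T *m pi q = v^T; last exact: pT.
    apply/eqP; rewrite eq_sym -subr_eq0 -{1}[v^T]mulmx1 -mulmxBr; apply/eqP.
    by apply: trmx_inj; rewrite trmx_mul trmxK piv trmx0.
  apply: trmx_inj; rewrite trmx0; apply: (dual_nondegenerate Mq uq) => [w wq|].
    rewrite (smooth_2form_skew ss Mq) // Cq // /form_at trmxK.
    by rewrite -(pid w wq) -!mulmxA [pi q *m _]mulmxA Cv mulmx0 mxE oppr0.
  by rewrite Dq // -[D q]trmxK -trmx_mul Dv trmx0.
have [L [rL LA]] := regmx_left_inverse Mq rA Ainj.
apply: regmx_congr (regmxM Mq rL rB).
by apply: filterS2 LA AP => p LAp <-; rewrite mulmxA LAp mul1mx.
Qed.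

(** The rows of A are the vectors P^# c and (e_k)_M, which span the tangent
    space; adding the rows of 1 - pi, a complement, gives a matrix of full rank
    with a left inverse L.  Writing u = u L_1 A for tangent u, with L_1 the part
    of L that multiplies A, yields sigma(u, v) = u L_1 B v^T, where B holds the
    known values sigma(A_i, v). *)
Lemma bivector_algebraic_form : algebraic_bivector M P -> algebraic_2form M sigma.
Proof.
move=> [_ AP]; apply: algebraic_2form_of => // q Mq.
have rP : regmx M P q by move=> i j; apply: (regularE _ _).1 => //; exact: AP.
have [pi [rpi dpi]] := tangent_projector (@vset_nonsingular _ _ V) Mq.
have [F [rF dF]] := regmx_fund Mq.
have [ML [MR [rL rR dLR]]] := regmx_mc hPhi Mq.
have [R [rRh dR]] := regmx_rho hPhi Mq.
have [B0 B0E] := linear_on_matrix he (fun k => hbil (he.1 k)).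
pose A p := col_mx (P p) (E *m F p).
pose B p := col_mx (1%:M - 4^-1 *: R p)^T (2^-1 *: ((ML p + MR p) *m B0)^T).
have r1 k l (X : 'M[K]_(k, l)) : regmx M (fun=> X) q by exact: regmx_cst.
have rA : regmx M A q by apply: regmx_col => //; exact: regmxM.
have rB : regmx M B q.
  apply: regmx_col; first by apply: regmxT; apply: regmxB => //; exact: regmxZ.
  by apply: regmxZ => //; apply: regmxT; apply: regmxM => //; exact: regmxD.
have r2 : regmx M (fun p => col_mx (A p) (1%:M - pi p)) q.
  by apply: regmx_col => //; exact: regmxB.
have inj (v : 'cV_(vdim V)) : col_mx (A q) (1%:M - pi q) *m v = 0 -> v = 0.
  have [pT pid] := znbhs_point Mq dpi; have Fq := znbhs_point Mq dF.
  rewrite /A !mul_col_mx -[X in _ = X](@col_mx0 _ _ _ _); move=> /eq_col_mx[+ piv].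
  rewrite -[X in _ = X](@col_mx0 _ _ _ _) => /eq_col_mx[Pv Fv].
  rewrite -[v]mul1mx -[RHS](mul0mx _ v).
  have -> : v = pi q *m v.
    by apply/eqP; rewrite -subr_eq0 -{1}[v]mul1mx -mulmxBl piv.
  rewrite !mulmxA; apply: eq_mulmxr => w; rewrite !mulmxA mulmx1 mulmx0 !mul0mx.
  set u := w *m pi q; have uq : tangent M q u by exact: pT.
  have [_ _ /(_ q u Mq uq) sh] := dual.
  have [X lX rhoX] := rho_fund hPhi Mq uq.
  (* A has the right row space: duality decomposes the tangent vector u *)
  have {sh} -> : u = sharp P q (flat sigma q u) + 4^-1 *: rho Phi q u.
    by rewrite sh subrK.
  rewrite mulmxDl /sharp -mulmxA Pv mulmx0 add0r -scalemxAl rhoX Fq //.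
  by have [a ->] := lie_coord he lX; rewrite -!mulmxA [E *m _]mulmxA Fv mulmx0 scaler0.
have [L [rLi LA]] := regmx_left_inverse Mq r2 inj.
exists (fun p => lsubmx (L p) *m B p); split.
  by apply: regmxM => //; exact: regmx_lsub.
have d1 := znbhsI dpi dF; have d2 := znbhsI dLR dR; have d := znbhsI d1 d2.
apply: filterS3 d LA (znbhs_base M q) => p [[[pT pid] Fp] [LRp Rp]] LAp Mp u v up vp.
have [skew tP] := bP Mp.
have Api : A p *m pi p = A p.
  rewrite /A mul_col_mx; congr col_mx; apply/row_matrixP => i.
    by rewrite row_mul pid.
  rewrite row_mul pid // row_mul rowK -Fp; last exact: he.1.
  by apply: fund_tangent => //; exact: he.1.
have uLA : u = u *m lsubmx (L p) *m A p.
  rewrite -{1}(pid u up) -{1}[u]mulmx1 -LAp -{1}[L p]hsubmxK mul_row_col.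
  rewrite mulmxDr mulmxDl -!mulmxA Api mulmxBl mul1mx.
  have -> : pi p *m pi p = pi p by apply: eq_mulmxr => w; rewrite mulmxA pid.
  by rewrite subrr !mulmx0 addr0.
have formE k (X : 'M_(k, vdim V)) i :
    (X *m sigma p *m v^T) i 0 = form_at (sigma p) (row i X) v.
  by rewrite /form_at -!row_mul [RHS]mxE.
have AB : A p *m sigma p *m v^T = B p *m v^T.
  rewrite /A /B !mul_col_mx; congr col_mx; apply/colP => i; rewrite formE.
    (* the transposed duality relation: sigma(P_i, v) = - sigma(v, P_i) = (v sigma P)_i *)
    rewrite (smooth_2form_skew ss Mp (tP i) vp).
    have -> : form_at (sigma p) v (row i (P p)) = - (v *m sigma p *m P p) 0 i.
      rewrite /form_at tr_row skew colE mulmxA mulmxN mulNmx -colE mxE.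
      by congr (- _); rewrite mxE.
    by rewrite opprK (duality_matrix Mp Rp vp) -trmx_mul [RHS]mxE.
  rewrite row_mul rowK -Fp; last exact: he.1.
  have [mS _ _] := dual; rewrite mS //; last exact: he.1.
  have t := dPhi_tangent hPhi Mp vp; have GP := PhiG hPhi Mp.
  rewrite B0E; last by apply: tangentD; [exact: mcL_lie | exact: mcR_lie].
  have [-> ->] := LRp v vp.
  by rewrite -mulmxDr -mulmxA -scalemxAl [RHS]mxE -trmx_mul [in RHS]mxE.
by rewrite {1}uLA /form_at -!mulmxA [A p *m _]mulmxA AB.
Qed.

End Duality.

Theorem corollary7p10 (R : realType) (K : numFieldType)
    (hK : K = R :> numFieldType \/ K = R[i] :> numFieldType)
    (G : affine_group K) (V : affine_gvariety G)
    (Phi : 'rV[K]_(vdim V) -> 'rV[K]_(gdim G)) (hPhi : equivariant_morphism Phi)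
    (bil : 'rV[K]_(gdim G) -> 'rV[K]_(gdim G) -> K)
    (hbil : invariant_inner_product bil)
    (r : nat) (e : 'I_r -> 'rV[K]_(gdim G)) (he : lie_basis e)
    (eta : 'M[K]_r) (heta : invariant_symmetric_tensor e eta)
    (hinv : inverse_tensor bil e eta)
    (sigma P : 'rV[K]_(vdim V) -> 'M[K]_(vdim V))
    (hP : hamiltonian_quasi_poisson Phi e eta P)
    (hsigma : weakly_quasi_hamiltonian Phi bil sigma)
    (hdual : momentum_dual Phi bil e eta sigma P) :
  Phi_nondegenerate Phi sigma /\
  (algebraic_2form (vset V) sigma <-> algebraic_bivector (vset V) P).
Proof.
have [[bP _] _ _ _] := hP; have [ss _ _ _] := hsigma; have [lbil _ _ _] := hbil.
split; first exact: dual_nondegenerate bP hdual.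
split.
  exact (form_algebraic_bivector hPhi he bP ss hdual).
exact (bivector_algebraic_form hPhi lbil he bP ss hdual).
Qed.
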